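(* Let $n>1$ and let $G$ be a locally nilpotent group with an $n$-cyclotomic automorphism. Let $p$ be the largest prime divisor of $n$. Then every $k$-generated subgroup $N$ of $G$ is nilpotent of class $\operatorname{c}(N)\le\max\{(p-1)^{2^{(p-1)}},\ \operatorname{C}((2p-3)\cdot k,\,p)\}$.
   Context: For $n>1$, an automorphism $\alpha$ of $G$ is $n$-cyclotomic if, writing $\Phi_n(t)=b_0+\cdots+b_et^e$ (the $n$-th cyclotomic polynomial), $x^{b_0}\alpha(x^{b_1})\cdots\alpha^e(x^{b_e})=1_G$ for all $x\in G$. $\operatorname{C}(d,p)$ denotes a natural number (depending only on $d$ and the prime $p$; its existence is a theorem of Khukhro) such that every finite $p$-group on $d$ generators admitting a $p$-cyclotomic automorphism is nilpotent of class at most $\operatorname{C}(d,p)$. *)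

(* Defs.v *)
From mathcomp Require Import all_boot all_order all_algebra all_fingroup all_solvable all_field.
From mathcomp Require Import pgroup nilpotent.
Set Implicit Arguments. Unset Strict Implicit. Unset Printing Implicit Defensive.
Import GRing.Theory.

Section Cyclo.
Variables (T : Type) (mul : T -> T -> T) (one : T) (inv : T -> T).

Definition zpow_gen (x : T) (z : int) : T :=
  match z with
  | Posz m => iter m (mul x) one
  | Negz m => inv (iter m.+1 (mul x) one)
  end.

Definition cyclo_word (n : nat) (a : T -> T) (x : T) : T :=
  foldr (fun i acc => mul (iter i a (zpow_gen x ('Phi_n)`_i)) acc) one
        (iota 0 (size ('Phi_n))).

Definition cyclotomic_map (n : nat) (a : T -> T) : Prop :=
  forall x, cyclo_word n a x = one.
End Cyclo.

Record grp := Grp {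
  carrier :> Type;
  gmul : carrier -> carrier -> carrier;
  gone : carrier;
  ginv : carrier -> carrier;
  gmulA : forall x y z, gmul x (gmul y z) = gmul (gmul x y) z;
  gmul1 : forall x, gmul gone x = x;
  gmulV : forall x, gmul (ginv x) x = gone
}.

Section AbsGroup.
Variable G : grp.

Inductive gen (S : G -> Prop) : G -> Prop :=
| gen_one : gen S (gone G)
| gen_in x : S x -> gen S x
| gen_mul x y : gen S x -> gen S y -> gen S (gmul x y)
| gen_inv x : gen S x -> gen S (ginv x).

Definition gcomm (x y : G) : G := gmul (gmul (ginv x) (ginv y)) (gmul x y).

(* lower central series of a subgroup N: lcs N i = gamma_{i+1}(N) *)
Fixpoint lcs (N : G -> Prop) (i : nat) : G -> Prop :=
  match i with
  | 0 => N
  | i.+1 => gen (fun z => exists x y, lcs N i x /\ N y /\ z = gcomm x y)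
  end.

Definition nil_class_le (N : G -> Prop) (c : nat) : Prop :=
  forall z, lcs N c z -> z = gone G.

Definition locally_nilpotent : Prop :=
  forall (m : nat) (g : 'I_m -> G),
    exists c, nil_class_le (gen (fun x => exists i, x = g i)) c.

Definition is_automorphism (a : G -> G) : Prop :=
  bijective a /\ forall x y, a (gmul x y) = gmul (a x) (a y).

Definition n_cyclotomic_aut (n : nat) (a : G -> G) : Prop :=
  is_automorphism a /\ cyclotomic_map (@gmul G) (gone G) (@ginv G) n a.
End AbsGroup.

(* ---- Khukhro's constant: property of a candidate C(d,p) ----
   every finite p-group on d generators admitting a p-cyclotomic
   automorphism is nilpotent of class <= C d p. Finite groups are
   represented by finGroupTypes (the whole group [set: gT]). *)
Definition Khukhro_bound (C : nat -> nat -> nat) : Prop :=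
  forall (d p : nat), prime p ->
  forall (gT : finGroupType),
    pgroup p [set: gT] ->
    (exists t : d.-tuple gT, <<[set x in t]>>%g = [set: gT]) ->
    (exists a : gT -> gT,
        [/\ bijective a, {morph a : x y / (x * y)%g} &
            cyclotomic_map mulg (1%g : gT) invg p a]) ->
    nilpotent [set: gT] /\ nil_class [set: gT] <= C d p.

(* Main.v *)
(* On an abelian section of G the cyclotomic identity says that Phi_n(alpha) = 0.
   Since Phi_n divides Phi_r(X^(n/r)) for every prime r dividing n, the power
   beta = alpha^(n/r) satisfies 1 + beta + ... + beta^(r-1) = 0 there.  Extending
   the Lie ring of the lower central series, modulo its r-torsion, by the group
   ring of a cyclic group of order r turns beta into a (Z/r)-grading with trivial
   zero component.  By Kreknin's theorem such a Lie ring is solvable of derived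
   length at most 2^(r-1) - 1, and a subset-sum argument in Z/r then bounds its
   class by (r-1)^(2^(r-1)).  Hence, beyond that class, the factors of the lower
   central series of a finitely generated alpha-invariant subgroup are r-torsion.

   If n has two prime divisors these factors vanish, and nilpotency concludes.
   Otherwise n is a power of p and a power of alpha is p-cyclotomic; an element z
   of a non-trivial factor survives in a quotient by a normal invariant subgroup K
   maximal subject to not containing z.  All non-trivial invariant normal subgroups
   of the quotient contain z, which forces its centre to have p-power exponent,
   so that the quotient is a finite p-group and Khukhro's bound applies. *)
From HB Require Import structures.
Require Import Defs.
From mathcomp Require Import all_boot all_order all_algebra all_fingroup all_solvable all_field.
From mathcomp Require Import zify ring boolp.
From mathcomp Require classical_sets.
Set Implicit Arguments. Unset Strict Implicit. Unset Printing Implicit Defensive.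
Import GRing.Theory.

(** * Graded Lie rings with trivial zero component *)

Local Open Scope ring_scope.

(** In a non-abelian group the cyclotomic word does not pass to multiples of Phi_n. Only for a power
    n of p are the word of n in alpha and the word of p in a power of alpha literally the same
    product; hence the Lie ring serves every prime divisor of n, while Khukhro's bound is reached
    for prime powers only. The Lie ring has no r-th root of unity with which to split beta. The
    generator t of the cyclic group takes its place, and r - (1 + t + ... + t^(r-1)) carries every
    element into the sum of the nonzero components, at the cost of powers of r that are harmless
    once r-torsion is factored out. With s = 2^(r-1) - 1 the class obtained is the geometric sum 1 +
    (r-1) + ... + (r-1)^(s-1). The Lie ring sees only successive factors, so what is proved is that
    two consecutive terms of the lower central series agree; the unknown class supplied by local
    nilpotency then finishes. N need not be alpha-invariant, so the argument runs in a group
    generated by iterates of its generators. For a p-cyclotomic map p - 1 iterates suffice, and p -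
    1 <= 2p - 3. *)

Record lie_bracket (V : zmodType) (br : V -> V -> V) : Prop := LieBracket {
  brDl : forall x y z, br (x + y) z = br x z + br y z;
  brDr : forall x y z, br z (x + y) = br z x + br z y;
  brC : forall x y, br x y = - br y x;
  br_jacobi : forall x y z, br (br x y) z + br (br y z) x + br (br z x) y = 0
}.

Section LieBracketTheory.
Variables (V : zmodType) (br : V -> V -> V).
Hypothesis Hbr : lie_bracket br.

Lemma br0l x : br 0 x = 0.
Proof. by apply: (addrI (br 0 x)); rewrite -(brDl Hbr) !addr0. Qed.

Lemma br0r x : br x 0 = 0.
Proof. by rewrite (brC Hbr) br0l oppr0. Qed.

Lemma brNl x y : br (- x) y = - br x y.
Proof. by apply: (addrI (br x y)); rewrite -(brDl Hbr) !subrr br0l. Qed.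

Lemma brNr x y : br x (- y) = - br x y.
Proof. by rewrite (brC Hbr) brNl (brC Hbr x). Qed.

Lemma brBl x y z : br (x - y) z = br x z - br y z.
Proof. by rewrite (brDl Hbr) brNl. Qed.

Lemma brBr x y z : br z (x - y) = br z x - br z y.
Proof. by rewrite (brDr Hbr) brNr. Qed.

Lemma br_suml J (s : seq J) (P : pred J) F y :
  br (\sum_(j <- s | P j) F j) y = \sum_(j <- s | P j) br (F j) y.
Proof.
by apply: (big_morph (fun x => br x y)) => [u v|]; rewrite ?(brDl Hbr) ?br0l.
Qed.

Lemma br_sumr J (s : seq J) (P : pred J) F y :
  br y (\sum_(j <- s | P j) F j) = \sum_(j <- s | P j) br y (F j).
Proof.
by apply: (big_morph (br y)) => [u v|]; rewrite ?(brDr Hbr) ?br0r.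
Qed.

Lemma brMnl x y m : br (x *+ m) y = br x y *+ m.
Proof. by elim: m => [|m IH]; rewrite ?mulr0n ?br0l // !mulrS (brDl Hbr) IH. Qed.

Lemma brMnr x y m : br x (y *+ m) = br x y *+ m.
Proof. by rewrite (brC Hbr) brMnl (brC Hbr x) mulNrn. Qed.

Lemma br_leibniz x y z : br x (br y z) = br (br x y) z - br (br x z) y.
Proof.
rewrite (brC Hbr x (br y z)) (brC Hbr x z) brNl opprK.
apply/eqP; rewrite eq_sym -subr_eq0 opprK addrAC; apply/eqP.
exact: br_jacobi Hbr _ _ _.
Qed.

Lemma br_swap x y z : br (br x y) z = br (br x z) y + br x (br y z).
Proof. by rewrite br_leibniz addrC subrK. Qed.

Definition leftnormed (x : V) (ys : seq V) := foldl br x ys.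

Lemma leftnormed0 ys : leftnormed 0 ys = 0.
Proof. by elim: ys => //= y ys; rewrite br0l. Qed.

Lemma leftnormedD x x' ys :
  leftnormed (x + x') ys = leftnormed x ys + leftnormed x' ys.
Proof. by elim: ys x x' => //= y ys IH x x'; rewrite (brDl Hbr) IH. Qed.

Lemma leftnormedB x x' ys :
  leftnormed (x - x') ys = leftnormed x ys - leftnormed x' ys.
Proof. by elim: ys x x' => //= y ys IH x x'; rewrite brBl IH. Qed.

End LieBracketTheory.

Section Span.
Variable V : zmodType.

Inductive span (S : V -> Prop) : V -> Prop :=
| span0 : span S 0
| span_in x : S x -> span S x
| spanB x y : span S x -> span S y -> span S (x - y).

Lemma spanN S x : span S x -> span S (- x).
Proof. by move=> Sx; rewrite -sub0r; apply: spanB => //; apply: span0. Qed.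

Lemma spanD S x y : span S x -> span S y -> span S (x + y).
Proof. by move=> Sx Sy; rewrite -[y]opprK; apply/spanB/spanN. Qed.

Lemma span_sum S J (s : seq J) (P : pred J) F :
  (forall j, P j -> span S (F j)) -> span S (\sum_(j <- s | P j) F j).
Proof. by move=> h; apply: big_ind => //; [apply: span0 | apply: spanD]. Qed.

Definition subgroup_pred (P : V -> Prop) :=
  P 0 /\ forall x y, P x -> P y -> P (x - y).

Lemma span_subgroup S : subgroup_pred (span S).
Proof. by split; [apply: span0 | apply: spanB]. Qed.

Lemma span_min S (P : V -> Prop) :
  subgroup_pred P -> (forall x, S x -> P x) -> forall x, span S x -> P x.
Proof. by move=> [P0 PB] SP x; elim=> // u v _ Pu _ Pv; apply: PB. Qed.

Lemma subgroup_predD (P : V -> Prop) x y :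
  subgroup_pred P -> P x -> P y -> P (x + y).
Proof.
move=> [P0 PB] Px Py; rewrite -[y]opprK; apply: (PB) => //.
by rewrite -sub0r; apply: PB.
Qed.

End Span.

Section GradedLie.
Variables (V : zmodType) (br : V -> V -> V).
Hypothesis Hbr : lie_bracket br.
Variable p : nat.
Hypothesis p_pr : prime p.

Definition family := 'F_p -> V -> Prop.

Definition subfam (U W : family) := forall i x, U i x -> W i x.

Definition brfam (U W : family) : family := fun i =>
  span (fun z => exists u v x y, [/\ U u x, W v y, u + v = i & z = br x y]).

Lemma brfam_subgroup U W i : subgroup_pred (brfam U W i).
Proof. exact: span_subgroup. Qed.

Lemma brfam_in (U W : family) u v x y :
  U u x -> W v y -> brfam U W (u + v) (br x y).
Proof. by move=> Ux Wy; apply: span_in; exists u, v, x, y. Qed.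

Lemma brfam_min (U W X : family) :
  (forall i, subgroup_pred (X i)) ->
  (forall u v x y, U u x -> W v y -> X (u + v) (br x y)) ->
  subfam (brfam U W) X.
Proof.
move=> gX h i; apply: span_min => // _ [u [v [x [y [Ux Wy <- ->]]]]].
exact: h.
Qed.

Lemma brfamS (U U' W W' : family) :
  subfam U U' -> subfam W W' -> subfam (brfam U W) (brfam U' W').
Proof.
move=> sU sW; apply: brfam_min => [i|u v x y Ux Wy]; first exact: brfam_subgroup.
by apply: brfam_in; [apply: sU | apply: sW].
Qed.

(* A "graded Lie ring with trivial zero component", given by its homogeneous
   components only; the sum of the components need not be direct. *)
Record zerofree (L : family) : Prop := ZeroFree {
  zf_sub : forall i, subgroup_pred (L i);
  zf_br : forall u v x y, L u x -> L v y -> L (u + v) (br x y);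
  zf_0 : forall x, L 0 x -> x = 0
}.

Fixpoint derfam (L : family) (m : nat) : family :=
  if m is m'.+1 then brfam (derfam L m') (derfam L m') else L.

Fixpoint lcfam (L : family) (m : nat) : family :=
  if m is m'.+1 then brfam (lcfam L m') L else L.

Lemma zerofree_sub (L M : family) :
  zerofree L -> subfam M L -> (forall i, subgroup_pred (M i)) ->
  (forall u v x y, M u x -> M v y -> M (u + v) (br x y)) -> zerofree M.
Proof. by move=> ZL sML gM bM; split=> // x /sML/(zf_0 ZL). Qed.

Lemma brfam_zf (L : family) : zerofree L -> subfam (brfam L L) L.
Proof. by move=> ZL; apply: brfam_min; [apply: zf_sub | apply: zf_br]. Qed.

Lemma zerofree_brfam (L : family) : zerofree L -> zerofree (brfam L L).
Proof.
move=> ZL; apply: (zerofree_sub ZL); first exact: brfam_zf.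
  by move=> i; apply: brfam_subgroup.
by move=> u v x y /(brfam_zf ZL) Lx /(brfam_zf ZL) Ly; apply: brfam_in.
Qed.

Lemma zerofree_derfam (L : family) m : zerofree L -> zerofree (derfam L m).
Proof. by move=> ZL; elim: m => //= m; apply: zerofree_brfam. Qed.

Lemma derfam_sub (L : family) m : zerofree L -> subfam (derfam L m) L.
Proof.
move=> ZL; elim: m => //= m IH i x /(brfam_zf (zerofree_derfam m ZL)).
exact: IH.
Qed.

Lemma derfamD (L : family) m m' : derfam L (m + m') = derfam (derfam L m) m'.
Proof. by elim: m' => [|m' IH]; rewrite ?addn0 // addnS /= IH. Qed.

(** Degrees are compared through their representatives in 0..p-1. For k = 0 this is all of a
    zero-free L and for k = p - 1 it is zero; Kreknin's elimination passes from one to the other. *)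
Inductive genabove (L : family) (k : nat) : family :=
| ga_in (i : 'F_p) x : (k < i)%N -> L i x -> genabove L k i x
| ga_0 i : genabove L k i 0
| ga_B i x y : genabove L k i x -> genabove L k i y -> genabove L k i (x - y)
| ga_br u v x y : genabove L k u x -> genabove L k v y ->
    genabove L k (u + v) (br x y).

Lemma genabove_subgroup L k i : subgroup_pred (genabove L k i).
Proof. by split; [apply: ga_0 | apply: ga_B]. Qed.

Lemma genabove_zf (L : family) k : zerofree L -> subfam (genabove L k) L.
Proof.
move=> ZL i x; elim=> {i x} [i x _ //|i|i x y _ Lx _ Ly|u v x y _ Lx _ Ly].
- by case: (zf_sub ZL i).
- by case: (zf_sub ZL i) => _; apply.
- exact: zf_br.
Qed.

(** The Jacobi identity turns [x, [y, z]] into left-normed brackets, so the right factor can be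
    broken up until it is a homogeneous generator. *)
Lemma genabove_last (L : family) k u v x y : zerofree L ->
  genabove L k u x -> genabove L k v y ->
  brfam (genabove L k) (fun (j : 'F_p) z => (k < j)%N /\ L j z) (u + v) (br x y).
Proof.
move=> ZL Gx Gy; elim: Gy u x Gx
    => {v y} [i y ki Ly|i|i y z _ IHy _ IHz|i j y z Gy IHy Gz IHz] u x Gx.
- exact: brfam_in.
- by rewrite (br0r Hbr); apply: span0.
- by rewrite (brBr Hbr); apply: spanB; [apply: IHy | apply: IHz].
- rewrite (br_leibniz Hbr); apply: spanB.
  + by rewrite addrA; apply: IHz; apply: ga_br.
  + by rewrite [i + j]addrC addrA; apply: IHy; apply: ga_br.
Qed.

Lemma ltn_Fp (i : 'F_p) : (i < p)%N.
Proof. exact: leq_trans (ltn_ord i) (eq_leq (Fp_cast p_pr)). Qed.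

Lemma val_FpD (i j : 'F_p) :
  (i + j)%N = (i + j)%R \/ (i + j)%N = ((i + j)%R + p)%N.
Proof.
have li := ltn_Fp i; have lj := ltn_Fp j.
have -> : nat_of_ord (i + j)%R = ((i + j) %% p)%N.
  by rewrite /= [in X in (_ %% X)%N](Fp_cast p_pr).
case: (ltnP (i + j) p) => h; first by left; rewrite modn_small.
right; rewrite -{2}(subnK h) modnDr modn_small ?subnK //; lia.
Qed.

(** The last factor can be taken homogeneous of degree v > k, and the other one has degree u <> 0
    because the zero component vanishes. Then u + v = k + 1 forces a carry modulo p, so that both u
    and v exceed k + 1. *)
Lemma genabove_degree (L : family) k x : zerofree L ->
  brfam (genabove L k) (genabove L k) k.+1%:R x -> (k.+1 < p)%N ->
  genabove L k.+1 k.+1%:R x.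
Proof.
move=> ZL Bx kp.
have vk : nat_of_ord (k.+1%:R : 'F_p) = k.+1.
  by rewrite val_Fp_nat // modn_small.
have {Bx} : brfam (genabove L k) (fun (j : 'F_p) z => (k < j)%N /\ L j z) k.+1%:R x.
  move: {vk} (k.+1%:R) Bx => i; apply: span_min; first exact: span_subgroup.
  by move=> _ [u [v [y [z [Gy Gz <- ->]]]]]; apply: genabove_last.
apply: span_min; first exact: genabove_subgroup.
move=> _ [u [v [y [z [Gy [kv Lz] uv ->]]]]].
have [u0|u0] := eqVneq u 0.
  by move: Gy; rewrite u0 => /(genabove_zf ZL)/(zf_0 ZL) ->; rewrite (br0l Hbr); apply: ga_0.
have u0' : (0 < u)%N by rewrite lt0n; apply: contra u0 => /eqP h; apply/eqP/val_inj.
have := val_FpD u v; rewrite uv vk => huv; rewrite -uv.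
have ltv := ltn_Fp v; have ltu := ltn_Fp u.
by apply: ga_br; apply: ga_in => //; [lia | apply: genabove_zf Gy | lia].
Qed.

(* Kreknin's theorem; the components are eliminated one after the other,
   each time doubling the derived length. *)
Lemma kreknin_step (L : family) k : zerofree L -> (k < p)%N ->
  subfam (derfam L (2 ^ k).-1) (genabove L k).
Proof.
elim: k L => [|k IH] L ZL kp.
  move=> i x /= Lx; have [i0|i0] := eqVneq i 0.
    by move: Lx; rewrite i0 => /(zf_0 ZL) ->; apply: ga_0.
  apply: ga_in => //; rewrite lt0n; apply: contra i0 => /eqP h.
  exact/eqP/val_inj.
have kp' : (k < p)%N by exact: ltnW.
have e1 : ((2 ^ k.+1).-1 = (2 ^ k).-1.+1 + (2 ^ k).-1)%N.
  by rewrite expnS; have := expn_gt0 2 k; lia.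
rewrite e1 derfamD => i x.
(* [N] is the derived ring of the term reached by the induction hypothesis for [L]. Applied to [N],
   the hypothesis yields generators of degree above k; those of degree exactly k + 1 are brackets of
   elements of [genabove L k] and fall under [genabove_degree]. *)
set N := derfam L (2 ^ k).-1.+1.
have ZN : zerofree N by apply: zerofree_derfam.
move/(IH N ZN kp'); elim=> {i x} [i x ki Nx|i|i x y _ Gx _ Gy|u v x y _ Gx _ Gy].
- case: (ltnP k.+1 i) => ki'.
    by apply: ga_in => //; apply: derfam_sub Nx.
  have ik : i = k.+1%:R.
    by apply/val_inj; rewrite /= val_Fp_nat // modn_small //; lia.
  rewrite ik; apply: genabove_degree => //; rewrite -ik.
  exact: (brfamS (IH L ZL kp') (IH L ZL kp') Nx).
- exact: ga_0.
- exact: ga_B.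
- exact: ga_br.
Qed.

(** No residue modulo p exceeds p - 1, so nothing nonzero is generated above degree p - 1. *)
Lemma kreknin (L : family) i x : zerofree L ->
  derfam L (2 ^ p.-1).-1 i x -> x = 0.
Proof.
have p0 := prime_gt0 p_pr.
move=> ZL /kreknin_step-/(_ ZL); rewrite prednK // => /(_ (leqnn _)).
elim=> {i x} [i x|//|i x y _ -> _ ->|u v x y _ -> _ _]; last first.
- exact: br0l.
- exact: subrr.
by have := ltn_Fp i; lia.
Qed.

(** * From solvability to nilpotency: subset sums in Z/p *)

Lemma translate_full (A : {set 'F_p}) (k : 'F_p) :
  k != 0 -> 0 \in A -> (forall d, d + k \in A -> d \in A) -> A = setT.
Proof.
move=> k0 A0 Ak; apply/setP => d; rewrite inE.
have h m : - (k *+ m) \in A.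
  elim: m => [|m IH]; first by rewrite mulr0n oppr0.
  by apply: Ak; rewrite mulrS opprD addrAC addNr sub0r.
have := h (- (d / k)); rewrite -mulr_natr natr_Zp mulrN opprK mulrC divfK //.
Qed.

Section Nilpotent.
Variables (L U U' : family).
Hypotheses (ZL : zerofree L).
Hypothesis gU' : forall i, subgroup_pred (U' i).
Hypothesis U'L : forall u v x y, U' u x -> L v y -> U' (u + v) (br x y).
Hypothesis UL : forall u v x y, U u x -> L v y -> U (u + v) (br x y).
Hypothesis U0 : forall x, U 0 x -> x = 0.
Hypothesis UM : forall u v x y, U u x -> brfam L L v y -> U' (u + v) (br x y).

Definition homog (dy : 'F_p * V) := L dy.1 dy.2.

Fixpoint all_homog (ys : seq ('F_p * V)) : Prop :=
  if ys is y :: ys' then homog y /\ all_homog ys' else True.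

Definition lnh (x : V) (ys : seq ('F_p * V)) := leftnormed br x (unzip2 ys).

Definition degs (ys : seq ('F_p * V)) := \sum_(y <- ys) y.1.

Lemma lnh_U' x d ys : U' d x -> all_homog ys -> U' (d + degs ys) (lnh x ys).
Proof.
elim: ys x d => [|y ys IH] x d U'x /=; first by rewrite /degs big_nil addr0.
move=> [hy hys]; rewrite /degs big_cons addrA /lnh /=.
by apply: IH => //; apply: U'L.
Qed.

(** Since [U, [L, L]] lies in [U'], elements of L act on [U] modulo [U'] by commuting operators, and
    [y] may be moved behind [ys]. *)
Lemma lnh_swap x d y ys : U d x -> homog y -> all_homog ys ->
  U' (d + y.1 + degs ys) (lnh (br x y.2) ys - br (lnh x ys) y.2).
Proof.
move=> + hy; elim: ys x d => [|z ys IH] x d Ux /=.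
  by move=> _; rewrite /lnh /= subrr /degs big_nil; case: (gU' (d + y.1 + 0)).
move=> [hz hys]; rewrite /lnh /= (br_swap Hbr) (leftnormedD Hbr).
rewrite [X in U' _ X]addrAC /degs big_cons; apply: subgroup_predD => //.
  have -> : d + y.1 + (z.1 + \sum_(j <- ys) j.1) = (d + z.1) + y.1 + degs ys.
    by rewrite /degs !addrA [d + y.1 + z.1]addrAC.
  by apply: IH => //; apply: UL.
rewrite -[d + y.1 + _]addrA [y.1 + _]addrA [d + _]addrA.
by apply: lnh_U' => //; apply: UM => //; apply: brfam_in.
Qed.

(* Each further factor enlarges the set of degrees killed modulo U' by at least
   one element, since a proper nonempty subset of Z/p is not invariant under a
   nonzero translation. *)
Lemma lnh_kill ys : all_homog ys -> exists A : {set 'F_p},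
  [/\ 0 \in A, (A = setT \/ (size ys < #|A|)%N) &
      forall d x, d \in A -> U d x -> U' (d + degs ys) (lnh x ys)].
Proof.
elim: ys => [|y ys IH] /=.
  move=> _; exists [set 0]; split; first by rewrite set11.
    by right; rewrite cards1.
  move=> d x; rewrite inE => /eqP -> /U0 ->; rewrite /lnh /=.
  by case: (gU' (0 + degs [::])).
move=> [hy hys]; have [A [A0 cA kA]] := IH hys.
(* A degree killed by [ys] remains killed, as [y] can be applied last; a degree whose translate by
   [y.1] is killed by [ys] becomes killed, as [y] can be applied first. *)
have k1 d x : d \in A -> U d x -> U' (d + degs (y :: ys)) (lnh x (y :: ys)).
  move=> dA Ux; have := subgroup_predD (gU' _) (lnh_swap Ux hy hys).
  rewrite /degs big_cons addrA => /(_ (br (lnh x ys) y.2)).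
  rewrite subrK => h; apply: h.
  by rewrite addrAC; apply: U'L => //; apply: kA.
have k2 d x : d + y.1 \in A -> U d x -> U' (d + degs (y :: ys)) (lnh x (y :: ys)).
  move=> dA Ux; rewrite /degs big_cons addrA; apply: kA => //.
  exact: UL.
pose B := A :|: [set d | d + y.1 \in A].
have kB d x : d \in B -> U d x -> U' (d + degs (y :: ys)) (lnh x (y :: ys)).
  by rewrite !inE => /orP [] ? ?; [apply: k1 | apply: k2].
have [y0|y0] := eqVneq y.1 0.
  exists setT; split; [by rewrite inE|by left|].
  move=> d x _ Ux; move: hy; rewrite /homog y0 => /(zf_0 ZL) y20.
  rewrite /lnh /= y20 (br0r Hbr) (leftnormed0 Hbr).
  by case: (gU' (d + degs (y :: ys))).
exists B; split=> //; first by rewrite !inE A0.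
case: cA => [AT|cA].
  by left; apply/setP => d; rewrite !inE AT inE.
have [sBA|nBA] := boolP (B \subset A).
  left; have AT : A = setT.
    apply: (translate_full y0 A0) => d dA.
    by apply: (subsetP sBA); rewrite !inE dA orbT.
  by apply/setP => d; rewrite !inE AT inE.
right; apply: (leq_ltn_trans cA); apply: proper_card.
by rewrite /proper subsetUl.
Qed.

Lemma lnh_kill_all ys d x : size ys = p.-1 -> all_homog ys -> U d x ->
  U' (d + degs ys) (lnh x ys).
Proof.
move=> sy hys Ux; have [A [A0 cA kA]] := lnh_kill hys.
apply: kA => //; case: cA => [->|]; first by rewrite inE.
rewrite sy (prednK (prime_gt0 p_pr)) => cA.
suff -> : A = setT by rewrite inE.
apply/eqP; rewrite eqEcard subsetT cardsT.
by apply: leq_trans cA; rewrite card_ord (Fp_cast p_pr).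
Qed.

End Nilpotent.

Fixpoint iterbr (L U : family) (t : nat) : family :=
  if t is t'.+1 then brfam (iterbr L U t') L else U.

Lemma iterbrS L U t : iterbr L U t.+1 = iterbr L (brfam U L) t.
Proof. by elim: t => //= t ->. Qed.

Lemma iterbr_sub L U U' t : subfam U U' -> subfam (iterbr L U t) (iterbr L U' t).
Proof. by move=> sUU'; elim: t => //= t IH; apply: brfamS. Qed.

Lemma lcfam_iterbr L m t : lcfam L (m + t) = iterbr L (lcfam L m) t.
Proof. by elim: t => [|t IH]; rewrite ?addn0 // addnS /= IH. Qed.

(** Left-normed products with homogeneous entries span each component of [iterbr L U t]. *)
Lemma iterbr_min (L U X : family) t : (forall i, subgroup_pred (X i)) ->
  (forall ys d x, size ys = t -> all_homog L ys -> U d x -> X (d + degs ys) (lnh x ys)) ->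
  subfam (iterbr L U t) X.
Proof.
move=> gX; elim: t U => [|t IH] U h.
  by move=> i x Ux; have := h [::] i x erefl I Ux; rewrite /degs big_nil addr0.
rewrite iterbrS; apply: IH => ys d x sy hys.
pose P z := X (d + degs ys) (lnh z ys).
apply: (@span_min _ _ P).
  split; first by rewrite /P /lnh (leftnormed0 Hbr); case: (gX (d + degs ys)).
  move=> a b Pa Pb; rewrite /P /lnh (leftnormedB Hbr).
  by case: (gX (d + degs ys)) => _; apply.
move=> _ [u [v [a [b [Ua Lb uvd ->]]]]]; rewrite /P -uvd.
have := h ((v, b) :: ys) u a; rewrite /= sy => /(_ erefl (conj Lb hys) Ua).
by rewrite /degs big_cons addrA.
Qed.

(** The geometric sum 1 + (p-1) + ... + (p-1)^(s-1): one bracket enters the derived ring, and each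
    bracket inside the derived ring costs p - 1 brackets with the whole ring. *)
Fixpoint higman_class (s : nat) : nat :=
  if s is s'.+1 then (1 + p.-1 * higman_class s')%N else 0%N.

Lemma lcfam_ideal (L M : family) m u v x y :
  (forall i, subgroup_pred (M i)) ->
  (forall u v x y, M u x -> L v y -> M (u + v) (br x y)) ->
  lcfam M m u x -> L v y -> lcfam M m (u + v) (br x y).
Proof.
move=> gM ML; elim: m u v x y => [|m IH] u v x y /=; first exact: ML.
move=> + Ly; pose P z := brfam (lcfam M m) M (u + v) (br z y).
apply: (@span_min _ _ P).
  split; first by rewrite /P (br0l Hbr); apply: span0.
  by move=> a b Pa Pb; rewrite /P (brBl Hbr); apply: spanB.
move=> _ [i [j [a [b [Ma Mb iju ->]]]]]; rewrite /P -iju (br_swap Hbr).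
apply: spanD; last by rewrite -addrA; apply: brfam_in => //; apply: ML.
by rewrite addrAC; apply: brfam_in => //; apply: IH.
Qed.

Lemma lcfam_zf (L : family) m : zerofree L -> subfam (lcfam L m) L.
Proof.
move=> ZL; elim: m => //= m IH i x Bx; apply: (brfam_zf ZL).
by apply: brfamS Bx.
Qed.

(** Consecutive lower central terms of [L, L] play the parts of U and U' in [lnh_kill_all]: any p -
    1 brackets with L lead from one to the next. *)
Lemma lcfam_derived (L : family) m : zerofree L ->
  subfam (lcfam L (1 + p.-1 * m)) (lcfam (brfam L L) m).
Proof.
move=> ZL; elim: m => [|m IH]; first by rewrite muln0.
rewrite mulnS addnCA addnC lcfam_iterbr => i x.
move/(iterbr_sub IH); set M := brfam L L.
have ZM : zerofree M by apply: zerofree_brfam.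
have gM : forall i, subgroup_pred (M i) by move=> j; apply: brfam_subgroup.
have ML u v a b : M u a -> L v b -> M (u + v) (br a b).
  by move=> /(brfam_zf ZL) La Lb; apply: brfam_in.
apply: iterbr_min => [j|ys d y sy hys Uy]; first exact: brfam_subgroup.
apply: (@lnh_kill_all L (lcfam M m) (lcfam M m.+1)) => //.
- by move=> j; apply: brfam_subgroup.
- by move=> u v a b; apply: (lcfam_ideal (m := m.+1)).
- by move=> u v a b; apply: lcfam_ideal.
- by move=> a /(lcfam_zf ZM)/(zf_0 ZM).
- by move=> u v a b Ua Mb; apply: brfam_in.
Qed.

Lemma solvable_nilpotent (L : family) s : zerofree L ->
  (forall i x, derfam L s i x -> x = 0) ->
  forall i x, lcfam L (higman_class s) i x -> x = 0.
Proof.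
elim: s L => [|s IH] L ZL //= hs i x.
move/(lcfam_derived ZL); apply: IH; first exact: zerofree_brfam.
by move=> j y; rewrite -[brfam L L]/(derfam L 1) -derfamD => /hs.
Qed.

(** The strict bound [h] by (p-1)^(s+1) needs p - 1 >= 2 in its induction step; for p = 2 both sides
    of the claim equal 1. *)
Lemma higman_class_le : (higman_class (2 ^ p.-1).-1 <= p.-1 ^ (2 ^ p.-1))%N.
Proof.
have p1 := prime_gt1 p_pr.
have [p2|p2] := eqVneq p 2%N; first by rewrite p2 /= muln0.
have h s : (higman_class s < p.-1 ^ s.+1)%N.
  elim: s => [|s IH] /=; first by rewrite expn1; lia.
  rewrite expnS.
  have : (p.-1 * (higman_class s).+1 <= p.-1 * p.-1 ^ s.+1)%N by rewrite leq_mul2l IH orbT.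
  rewrite mulnS; move: (p.-1 * higman_class s)%N (p.-1 * p.-1 ^ s.+1)%N => A B; lia.
apply/ltnW/(leq_trans (h _)); rewrite prednK // expn_gt0 //.
Qed.

(** The components need not fill V: it is enough that the entries are sums of homogeneous elements,
    which is what [tracefree] will provide. *)
Lemma higman_graded (L : family) (x : V) (ys : seq V) : zerofree L ->
  let S := span (fun y => exists i, L i y) in
  S x -> (forall y, y \in ys -> S y) -> size ys = (p.-1 ^ (2 ^ p.-1))%N ->
  leftnormed br x ys = 0.
Proof.
move=> ZL S Sx Sys sy.
pose SL m := span (fun y => exists i, lcfam L m i y).
have SLS m y z : SL m y -> S z -> SL m.+1 (br y z).
  move=> my; elim=> [|w [j Lw]|w w' _ IH _ IH'].
  - by rewrite (br0r Hbr); apply: span0.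
  - elim: my => [|y' [i Ly]|y1 y2 _ IH1 _ IH2].
    + by rewrite (br0l Hbr); apply: span0.
    + by apply: span_in; exists (i + j); apply: brfam_in.
    + by rewrite (brBl Hbr); apply: spanB.
  - by rewrite (brBr Hbr); apply: spanB.
have h m zs y : SL m y -> (forall z, z \in zs -> S z) ->
    SL (m + size zs)%N (leftnormed br y zs).
  elim: zs m y => [|z zs IH] m y my Szs /=; first by rewrite addn0.
  rewrite -addSnnS; apply: IH.
    by apply: SLS => //; apply: Szs; rewrite inE eqxx.
  by move=> w wz; apply: Szs; rewrite inE wz orbT.
have := h 0%N ys x Sx Sys; rewrite add0n sy.
rewrite -(subnKC higman_class_le) /SL; elim=> [//|z [i]|a b _ -> _ ->]; last exact: subrr.
rewrite lcfam_iterbr => /(@iterbr_min L _ (fun _ w => w = 0)); apply.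
  by move=> j; split=> // a b -> ->; rewrite subrr.
move=> zs d w _ _ /(solvable_nilpotent ZL (fun i x => @kreknin L i x ZL)) ->.
exact: leftnormed0.
Qed.

End GradedLie.

(** * Lie rings with an automorphism of trivial trace *)

Section CyclicExtension.
Variables (V : zmodType) (br : V -> V -> V).
Hypothesis Hbr : lie_bracket br.
Variable r : nat.
Hypothesis r_pr : prime r.
Local Notation F := ('F_r).

Lemma sum_reflect (W : zmodType) (c : F) (f : F -> W) :
  \sum_a f a = \sum_a f (c - a).
Proof. by apply: (reindex_inj (h := fun a => c - a)) => a b /addrI/oppr_inj. Qed.

Lemma sum_translate (W : zmodType) (c : F) (f : F -> W) :
  \sum_a f a = \sum_a f (a - c).
Proof. by apply: (reindex_inj (h := fun a => a - c)) => a b /addIr. Qed.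

(* The bracket of V (x) Z[C_r], an element of which is a function on C_r. *)
Definition conv (f g : {ffun F -> V}) : {ffun F -> V} :=
  [ffun c => \sum_a br (f a) (g (c - a))].

Lemma conv_lie : lie_bracket conv.
Proof.
split=> [f g h|f g h|f g|f g h]; apply/ffunP => c; rewrite !ffunE.
- by rewrite -big_split; apply: eq_bigr => a _; rewrite ffunE (brDl Hbr).
- by rewrite -big_split; apply: eq_bigr => a _; rewrite ffunE (brDr Hbr).
- rewrite -sumrN (sum_reflect c); apply: eq_bigr => a _.
  by rewrite (brC Hbr) subKr.
have E (f1 f2 f3 : {ffun F -> V}) :
    \sum_a br (conv f1 f2 a) (f3 (c - a)) =
    \sum_a \sum_b br (br (f1 a) (f2 b)) (f3 (c - a - b)).
  under eq_bigr => a _ do rewrite ffunE (br_suml Hbr).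
  rewrite exchange_big; apply: eq_bigr => b _; rewrite [LHS](sum_translate (- b)).
  by apply: eq_bigr => a _; rewrite opprK addrK [a + b]addrC opprD addrA.
rewrite !E.
(* Both reindexings evaluate f, g, h at the points a, b, c - a - b in all three sums, so that the
   Jacobi identity of [br] applies termwise. *)
have -> : \sum_a \sum_b br (br (g a) (h b)) (f (c - a - b)) =
    \sum_a \sum_b br (br (g b) (h (c - a - b))) (f a).
  rewrite [RHS]exchange_big; apply: eq_bigr => a _.
  rewrite (sum_reflect (c - a)); apply: eq_bigr => b _.
  by rewrite subKr [c - b - a]addrAC.
have -> : \sum_a \sum_b br (br (h a) (f b)) (g (c - a - b)) =
    \sum_a \sum_b br (br (h (c - a - b)) (f a)) (g b).
  rewrite exchange_big; apply: eq_bigr => a _.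
  rewrite (sum_reflect (c - a)); apply: eq_bigr => b _.
  by rewrite [c - _ - a]addrAC subKr.
rewrite -!big_split big1 // => a _; rewrite -!big_split big1 // => b _.
exact: br_jacobi Hbr _ _ _.
Qed.

Variable beta : V -> V.
Hypothesis betaD : {morph beta : x y / x + y}.
Hypothesis beta_br : {morph beta : x y / br x y}.
Hypothesis beta_sum : forall x, \sum_(k < r) iter k beta x = 0.
Hypothesis tfree : forall x : V, x *+ r = 0 -> x = 0.

Let beta0 : beta 0 = 0.
Proof. by apply: (addrI (beta 0)); rewrite -betaD !addr0. Qed.

Let betaN : {morph beta : x / - x}.
Proof. by move=> x; apply: (addrI (beta x)); rewrite -betaD !subrr beta0. Qed.

Let beta_bigsum I (s : seq I) (P : pred I) (f : I -> V) :
  beta (\sum_(i <- s | P i) f i) = \sum_(i <- s | P i) beta (f i).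
Proof. exact: (big_morph beta betaD beta0). Qed.

(** Applying beta to the vanishing trace shifts each term by one; comparing the two sums leaves
    beta^r = 1. *)
Lemma beta_order x : iter r beta x = x.
Proof.
have h q : \sum_(k < q.+1) iter k beta x = 0 -> iter q.+1 beta x = x.
  move=> h0; have := congr1 beta h0; rewrite beta0 beta_bigsum big_ord_recr /= => h1.
  move: h0; rewrite big_ord_recl /= => h0.
  by apply: (addrI (\sum_(i < q) beta (iter i beta x))); rewrite h1 addrC.
by have := h r.-1; rewrite (prednK (prime_gt0 r_pr)); apply.
Qed.

Lemma iter_Fp (a b : F) x : iter (a + b)%R beta x = iter a beta (iter b beta x).
Proof.
rewrite -iterD; case: (val_FpD r_pr a b) => -> //.
by rewrite iterD beta_order.
Qed.

(** Writing f as the sum of the f(a) t^a, this says beta f = t^i f: the group element t acts as a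
    root of unity. *)
Definition eigen (i : F) (f : {ffun F -> V}) := forall a, beta (f a) = f (a - i).

(** In degree zero every value of f is fixed by beta, so its trace is r times itself; the trace
    vanishes and V has no r-torsion. *)
Lemma eigen_zerofree : zerofree conv eigen.
Proof.
split=> [i|u v f g Hf Hg c|f Hf].
- split=> [a|f g Hf Hg a]; rewrite !ffunE ?beta0 //.
  by rewrite betaD betaN Hf Hg.
- rewrite !ffunE beta_bigsum [RHS](sum_translate u).
  apply: eq_bigr => a _; rewrite beta_br Hf Hg; congr (br _ (g _)).
  by ring.
- apply/ffunP => a; rewrite ffunE; apply: tfree.
  have ba : beta (f a) = f a by rewrite Hf subr0.
  have it k : iter k beta (f a) = f a by elim: k => //= k ->.
  by have := beta_sum (f a); under eq_bigr do rewrite it; rewrite sumr_const card_ord.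
Qed.

(** For i <> 0 this is the sum over k of t^(-ik) beta^k x, the usual projection onto an eigenspace
    without division by r; the coefficient at a comes from k = -a/i in the field. *)
Definition eigvec (i : F) (x : V) : {ffun F -> V} :=
  [ffun a => iter (- a / i)%R beta x].

Lemma eigvecP i x : i != 0 -> eigen i (eigvec i x).
Proof.
move=> i0 a; rewrite !ffunE opprB mulrDl divff // mulNr iter_Fp.
by have -> : nat_of_ord (1 : F) = 1%N by [].
Qed.

(* Multiplication by r - (1 + t + ... + t^(r-1)), that is, r times the projection
   onto the part of V (x) Q[C_r] killed by 1 + t + ... + t^(r-1). *)
Definition tracefree (x : V) : {ffun F -> V} :=
  [ffun a => (if a == 0 then x *+ r else 0) - x].

Lemma sum_Fp (W : zmodType) (f : nat -> W) : \sum_(a : F) f a = \sum_(k < r) f k.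
Proof. by rewrite -!(big_mkord xpredT f) (Fp_cast r_pr). Qed.

(** At 0 each of the r - 1 eigenvectors has value x. At a <> 0 the map i -> -a/i permutes the
    nonzero residues, and the vanishing trace makes the sum equal to -x. *)
Lemma tracefree_eigvec x : tracefree x = \sum_(i | i != 0) eigvec i x.
Proof.
apply/ffunP => a; rewrite ffunE sum_ffunE.
under eq_bigr do rewrite ffunE.
have [->|a0] := eqVneq a 0.
  under eq_bigr do rewrite oppr0 mul0r /=.
  apply: (addIr x); rewrite subrK addrC.
  have <- : \sum_(i : F) x = x + \sum_(i : F | i != 0) x by rewrite (bigD1 0).
  by rewrite sumr_const card_ord (Fp_cast r_pr).
have -> : \sum_(i : F | i != 0) iter (- a / i)%R beta x =
          \sum_(k : F | k != 0) iter k beta x.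
  rewrite [RHS](reindex_onto (fun i => - a / i) (fun k => - a / k)) => [|k k0].
    apply: eq_bigl => i; have [->|i0] := eqVneq i 0.
      by rewrite invr0 mulr0 eqxx.
    by rewrite mulf_neq0 ?oppr_eq0 ?invr_eq0 //= invf_div mulrC divfK ?oppr_eq0 ?eqxx.
  by rewrite invf_div mulrC divfK ?oppr_eq0.
rewrite sub0r; apply: (addrI x); rewrite subrr.
by have := beta_sum x; rewrite -(sum_Fp (fun k => iter k beta x)) (bigD1 0) //= => ->.
Qed.

Lemma sum_tracefree x : \sum_a tracefree x a = 0.
Proof.
under eq_bigr do rewrite ffunE.
rewrite sumrB -big_mkcond big_pred1_eq sumr_const card_ord (Fp_cast r_pr).
exact: subrr.
Qed.

(** With N = 1 + t + ... + t^(r-1) one has (r - N)^2 = r (r - N): the constant part of the first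
    factor dies because the coefficients of the second sum to 0. *)
Lemma conv_tracefree x y :
  conv (tracefree x) (tracefree y) = tracefree (br x y) *+ r.
Proof.
apply/ffunP => c; rewrite ffunMnE ffunE.
under eq_bigr do rewrite [tracefree x _]ffunE (brBl Hbr).
rewrite sumrB -(br_sumr Hbr).
rewrite -(sum_reflect c (fun a => tracefree y a)) sum_tracefree (br0r Hbr) subr0.
rewrite (bigD1 (0 : F)) //= subr0 big1 ?addr0 => [|a /negPf ->]; last first.
  by rewrite (br0l Hbr).
rewrite (brMnl Hbr) !ffunE (brBr Hbr); congr ((_ - _) *+ r).
by case: eqP => _; rewrite ?(br0r Hbr) ?(brMnr Hbr).
Qed.

Lemma leftnormed_tracefree x ys :
  leftnormed conv (tracefree x) (map tracefree ys) =
  tracefree (leftnormed br x ys) *+ (r ^ size ys).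
Proof.
have lnMn f m gs : leftnormed conv (f *+ m) gs = leftnormed conv f gs *+ m.
  by elim: gs f => //= g gs IH f; rewrite (brMnl conv_lie) IH.
elim: ys x => //= y ys IH x.
by rewrite /= conv_tracefree lnMn IH expnS mulnC mulrnA.
Qed.

Theorem higman_automorphism x ys :
  (r.-1 ^ (2 ^ r.-1) <= size ys)%N -> leftnormed br x ys = 0.
Proof.
move=> sy; rewrite -(cat_take_drop (r.-1 ^ (2 ^ r.-1)) ys) /leftnormed foldl_cat.
rewrite [foldl _ x _](_ : _ = 0); first exact: leftnormed0.
move: (size_takel sy); move: (take _ ys) => {}ys {}sy.
have S z : span (fun f => exists i, eigen i f) (tracefree z).
  rewrite tracefree_eigvec; apply: span_sum => i i0.
  by apply: span_in; exists i; apply: eigvecP.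
have : leftnormed conv (tracefree x) (map tracefree ys) = 0.
  apply: (higman_graded conv_lie r_pr eigen_zerofree) => //; last by rewrite size_map.
  by move=> _ /mapP [z _ ->].
(* The coefficient at 1, which is not 0 in the field, returns the original product up to sign and a
   power of r. *)
rewrite leftnormed_tracefree => /ffunP/(_ 1); rewrite ffunMnE !ffunE oner_eq0 sub0r.
elim: (size ys) => [/eqP|m IH].
  by rewrite expn0 mulr1n oppr_eq0 => /eqP.
by rewrite expnS mulnC mulrnA => /tfree/IH.
Qed.

End CyclicExtension.

Local Close Scope ring_scope.

(** * Subgroups, quotients and the lower central series *)

Local Open Scope group_scope.

Record subgrp (G : groupType) (P : G -> Prop) : Prop := SubGrp {
  sg1 : P 1;
  sgM : forall x y, P x -> P y -> P (x * y);
  sgV : forall x, P x -> P x^-1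
}.

Definition conj_closed (G : groupType) (P : G -> Prop) :=
  forall x y : G, P x -> P (x ^ y).

Section Subgroups.
Variable G : groupType.
Implicit Types (P S : G -> Prop) (x y : G).

Lemma sgX P x m : subgrp P -> P x -> P (x ^+ m).
Proof.
move=> gP Px; elim: m => [|m IH]; first exact: sg1.
by rewrite expgS; apply: sgM.
Qed.

Lemma sgMl P x y : subgrp P -> P x -> P (x * y) -> P y.
Proof. by move=> gP Px Pxy; rewrite -(mulKg x y); apply: sgM => //; apply: sgV. Qed.

Lemma sgMr P x y : subgrp P -> P y -> P (x * y) -> P x.
Proof. by move=> gP Py Pxy; rewrite -(mulgK y x); apply: sgM => //; apply: sgV. Qed.

Lemma sgJ P x y : conj_closed P -> P (x ^ y) -> P x.
Proof. by move=> nP Pxy; have := nP _ y^-1 Pxy; rewrite conjgK. Qed.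

Lemma sgR P x y : subgrp P -> P [~ x, y] -> P [~ y, x].
Proof. by move=> gP /(sgV gP); rewrite invgR. Qed.

Inductive genp S : G -> Prop :=
| genp1 : genp S 1
| genp_in x : S x -> genp S x
| genpM x y : genp S x -> genp S y -> genp S (x * y)
| genpV x : genp S x -> genp S x^-1.

Lemma genp_subgrp S : subgrp (genp S).
Proof. by split; [apply: genp1 | apply: genpM | apply: genpV]. Qed.

Lemma genp_min S P : subgrp P -> (forall x, S x -> P x) ->
  forall x, genp S x -> P x.
Proof.
by move=> gP SP x; elim=> [|y /SP//|y z _ Py _ Pz|y _ Py];
  [apply: sg1 | apply: sgM | apply: sgV].
Qed.

Lemma genp_mono S S' : (forall x, S x -> S' x) -> forall x, genp S x -> genp S' x.
Proof.
move=> SS'; apply: genp_min; first exact: genp_subgrp.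
by move=> x /SS'; apply: genp_in.
Qed.

Lemma commgM x y z : [~ x, y * z] = [~ x, z] * [~ x, y] ^ z.
Proof. by rewrite /commg /conjg !invgM !mulgA !gnorm. Qed.

Lemma commMg x y z : [~ x * y, z] = [~ x, z] ^ y * [~ y, z].
Proof. by rewrite /commg /conjg !invgM !mulgA !gnorm. Qed.

Lemma commgV x y : [~ x, y^-1] = ([~ x, y]^-1) ^ y^-1.
Proof. by rewrite /commg /conjg !invgM !mulgA !gnorm. Qed.

Lemma conjg_commg x y : x ^ y = x * [~ x, y].
Proof. by rewrite /commg mulVKg. Qed.

Lemma hall_witt x y z :
  [~ x, y^-1, z] ^ y * [~ y, z^-1, x] ^ z * [~ z, x^-1, y] ^ x = 1.
Proof. by rewrite /commg /conjg !invgM !mulgA !gnorm. Qed.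

Lemma commr_subgrp P x : subgrp P -> conj_closed P ->
  subgrp (fun y => P [~ x, y]).
Proof.
move=> gP nP; split=> [|y z Py Pz|y Py].
- by rewrite commg1; apply: sg1.
- by rewrite commgM; apply: sgM => //; apply: nP.
- by rewrite commgV; apply: nP; apply: sgV.
Qed.

Lemma comml_subgrp P y : subgrp P -> conj_closed P ->
  subgrp (fun x => P [~ x, y]).
Proof.
move=> gP nP; have [h1 hM hV] := commr_subgrp y gP nP.
by split=> [|x z /(sgR gP) Px /(sgR gP) Pz|x /(sgR gP) Px]; apply: (sgR gP);
  [apply: h1 | apply: hM | apply: hV].
Qed.

Lemma genp_normal S : (forall x y, S x -> genp S (x ^ y)) -> conj_closed (genp S).
Proof.
move=> nS x y; elim=> [|z /nS//|z t _ Pz _ Pt|z _ Pz].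
- by rewrite conj1g; apply: genp1.
- by rewrite conjMg; apply: genpM.
- by rewrite conjVg; apply: genpV.
Qed.

(* gam i is the (i+1)-st term of the lower central series. *)
Fixpoint gam (i : nat) : G -> Prop :=
  if i is i'.+1 then genp (fun z => exists x y, gam i' x /\ z = [~ x, y])
  else fun _ => True.

Lemma gam_subgrp i : subgrp (gam i).
Proof. by case: i => [|i]; [split | apply: genp_subgrp]. Qed.

Lemma gam_normal i : conj_closed (gam i).
Proof.
elim: i => [|i IH] //=; apply: genp_normal => _ y [x [z [gx ->]]].
by rewrite conjRg; apply: genp_in; exists (x ^ y), (z ^ y); split=> //; apply: IH.
Qed.

Lemma gam_comm i x y : gam i x -> gam i.+1 [~ x, y].
Proof. by move=> gx; apply: genp_in; exists x, y. Qed.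

Lemma gamS i x : gam i.+1 x -> gam i x.
Proof.
apply: genp_min => [|_ [y [z [gy ->]]]]; first exact: gam_subgrp.
rewrite commgEl; apply: (sgM (gam_subgrp i)); last exact: gam_normal.
exact: (sgV (gam_subgrp i) gy).
Qed.

Lemma gam_le i j x : (i <= j)%N -> gam j x -> gam i x.
Proof. by move=> /subnKC <-; elim: (j - i)%N => [|m IH]; rewrite ?addn0 // addnS => /gamS. Qed.

(** The three subgroups argument, by induction on j for all i at once: in the Hall-Witt identity for
    u, v^-1 and x, the two factors other than the conjugate of [u, v, x] lie in the required
    term. *)
Lemma gam_commM i j x y : gam i x -> gam j y -> gam (i + j).+1 [~ x, y].
Proof.
elim: j i x y => [|j IH] i x y gx.
  by rewrite addn0 => _; apply: gam_comm.
have gN := gam_subgrp (i + j.+1).+1; have nN := @gam_normal (i + j.+1).+1.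
apply: (@genp_min _ (fun y => gam (i + j.+1).+1 [~ x, y])); first exact: commr_subgrp.
move=> _ [u [v [gu ->]]].
apply: (sgR gN); apply: (@sgJ _ _ v^-1 nN).
have := hall_witt u v^-1 x; rewrite invgK => HW.
have Vx : gam i x^-1 by exact: (sgV (gam_subgrp i) gx).
have Vu : gam j u^-1 by exact: (sgV (gam_subgrp j) gu).
have h2 : gam (i + j.+1).+1 ([~ v^-1, x^-1, u] ^ x).
  apply: nN; rewrite -addSnnS; apply: IH => //.
  by apply: (sgR (gam_subgrp _)); apply: gam_comm.
have h3 : gam (i + j.+1).+1 ([~ x, u^-1, v^-1] ^ u).
  by apply: nN; rewrite addnS; apply: gam_comm; apply: IH.
apply: (sgMr gN h2); apply: (sgMr gN h3).
by rewrite HW; apply: sg1.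
Qed.

End Subgroups.

Arguments gam {G} i x.
Arguments gam_subgrp {G} i.
Arguments gam_normal {G} i.

Section Morphisms.
Variables (G H : groupType) (f : G -> H).
Hypothesis fM : {morph f : x y / x * y}.

Lemma morph_g1 : f 1 = 1.
Proof. by apply: (mulgI (f 1)); rewrite -fM !mulg1. Qed.

Lemma morph_gV : {morph f : x / x^-1}.
Proof. by move=> x; apply: (mulgI (f x)); rewrite -fM !mulgV morph_g1. Qed.

Lemma morph_gR : {morph f : x y / [~ x, y]}.
Proof. by move=> x y; rewrite /commg /conjg !fM !morph_gV. Qed.

Lemma morph_gX m : {morph f : x / x ^+ m}.
Proof. by move=> x; elim: m => [|m IH]; rewrite ?morph_g1 // !expgS fM IH. Qed.

Lemma morph_gam i x : gam i x -> gam i (f x).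
Proof.
elim: i x => //= i IH x; elim=> [|_ [y [z [gy ->]]]|y z _ IHy _ IHz|y _ IHy].
- by rewrite morph_g1; apply: genp1.
- by rewrite morph_gR; apply: genp_in; exists (f y), (f z); split=> //; apply: IH.
- by rewrite fM; apply: genpM.
- by rewrite morph_gV; apply: genpV.
Qed.

Lemma morph_gam_surj i y : (forall z, exists x, f x = z) -> gam i y ->
  exists2 x, gam i x & f x = y.
Proof.
move=> fs; elim: i y => [|i IH] y /=; first by have [x] := fs y; exists x.
elim=> [|_ [u [v [/IH [x gx <-] ->]]]|u v _ [x gx <-] _ [z gz <-]|u _ [x gx <-]].
- by exists 1; [apply: genp1 | apply: morph_g1].
- have [z <-] := fs v; exists [~ x, z]; last exact: morph_gR.
  by apply: genp_in; exists x, z.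
- by exists (x * z); [apply: genpM | apply: fM].
- by exists x^-1; [apply: genpV | apply: morph_gV].
Qed.

End Morphisms.

Section Quotient.
Variables (G : groupType) (N : G -> Prop).

(** [choose] depends only on the coset as a predicate, so all its members receive the same
    representative, and the quotient can be the subtype of these representatives. *)
Definition quo_rep (x : G) : G := choose (fun y => `[< N (x^-1 * y) >]) x.

Definition quo_type (_ : subgrp N /\ conj_closed N) := {x : G | quo_rep x == x}.

Hypothesis hN : subgrp N /\ conj_closed N.

HB.instance Definition _ := SubChoice.on (quo_type hN).

Lemma quo_repP x : N (x^-1 * quo_rep x).
Proof.
apply/asboolP; apply: (chooseP (P := fun y => `[< N (x^-1 * y) >])).
by apply/asboolP; rewrite mulVg; case: hN => /sg1.
Qed.

Lemma quo_rep_eq x y : N (x^-1 * y) -> quo_rep x = quo_rep y.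
Proof.
case: hN => gN _ Nxy; rewrite /quo_rep.
have e : (fun z => `[< N (x^-1 * z) >]) =1 (fun z => `[< N (y^-1 * z) >]).
  move=> z; apply: asbool_equiv_eq; split=> h.
    have -> : y^-1 * z = (x^-1 * y)^-1 * (x^-1 * z).
      by rewrite invgM invgK -mulgA mulVKg.
    by apply: sgM => //; apply: sgV.
  have -> : x^-1 * z = (x^-1 * y) * (y^-1 * z) by rewrite -mulgA mulVKg.
  exact: sgM.
rewrite (eq_choose e); apply: choose_id; apply/asboolP.
  by rewrite -[_ * x]invgK invgM invgK; apply: sgV.
by rewrite mulVg; apply: sg1.
Qed.

Lemma quo_rep_id x : quo_rep (quo_rep x) == quo_rep x.
Proof. by apply/eqP/esym/quo_rep_eq/quo_repP. Qed.

Definition quo_cls (x : G) : quo_type hN := exist _ (quo_rep x) (quo_rep_id x).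

Lemma quo_cls_eq x y : quo_cls x = quo_cls y <-> N (x^-1 * y).
Proof.
have [gN _] := hN; split=> [[e]|Nxy]; last exact/val_inj/quo_rep_eq.
have -> : x^-1 * y = (x^-1 * quo_rep x) * (y^-1 * quo_rep y)^-1.
  by rewrite e invgM invgK mulgA mulgK.
by apply: (sgM gN); [apply: quo_repP | apply: (sgV gN); apply: quo_repP].
Qed.

Lemma quo_clsK (u : quo_type hN) : quo_cls (val u) = u.
Proof. by apply: val_inj; apply/eqP; apply: (valP u). Qed.

Definition quo_mul (u v : quo_type hN) := quo_cls (val u * val v).
Definition quo_inv (u : quo_type hN) := quo_cls (val u)^-1.

Lemma quo_clsM x y : quo_mul (quo_cls x) (quo_cls y) = quo_cls (x * y).
Proof.
have [gN nN] := hN; apply/esym/quo_cls_eq => /=.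
have -> : (x * y)^-1 * (quo_rep x * quo_rep y) =
    (x^-1 * quo_rep x) ^ y * (y^-1 * quo_rep y).
  by rewrite /conjg invgM !mulgA !gnorm.
by apply: sgM => //; [apply: nN; apply: quo_repP | apply: quo_repP].
Qed.

Lemma quo_clsV x : quo_inv (quo_cls x) = quo_cls x^-1.
Proof.
have [gN nN] := hN; apply/esym/quo_cls_eq => /=.
have -> : x^-1^-1 * (quo_rep x)^-1 = ((x^-1 * quo_rep x)^-1) ^ x^-1.
  by rewrite /conjg !invgM !mulgA !gnorm.
by apply: nN; apply: (sgV gN); apply: quo_repP.
Qed.

Lemma quo_mulA : associative quo_mul.
Proof.
by move=> u v w; rewrite -(quo_clsK u) -(quo_clsK v) -(quo_clsK w) !quo_clsM mulgA.
Qed.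
Lemma quo_mul1 : left_id (quo_cls 1) quo_mul.
Proof. by move=> u; rewrite -(quo_clsK u) quo_clsM mul1g. Qed.
Lemma quo_mulr1 : right_id (quo_cls 1) quo_mul.
Proof. by move=> u; rewrite -(quo_clsK u) quo_clsM mulg1. Qed.
Lemma quo_mulV : left_inverse (quo_cls 1) quo_inv quo_mul.
Proof. by move=> u; rewrite -(quo_clsK u) quo_clsV quo_clsM mulVg. Qed.
Lemma quo_mulrV : right_inverse (quo_cls 1) quo_inv quo_mul.
Proof. by move=> u; rewrite -(quo_clsK u) quo_clsV quo_clsM mulgV. Qed.

HB.instance Definition _ := isGroup.Build (quo_type hN)
  quo_mulA quo_mul1 quo_mulr1 quo_mulV quo_mulrV.

Lemma quotient_exists : exists (Q : groupType) (pi : G -> Q),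
  [/\ {morph pi : x y / x * y}, forall u, exists x, pi x = u
    & forall x, pi x = 1 <-> N x].
Proof.
exists (quo_type hN), quo_cls; split.
- by move=> x y; rewrite -quo_clsM.
- by move=> u; exists (val u); apply: quo_clsK.
- have [gN _] := hN; move=> x; rewrite -[1]/(quo_cls 1) quo_cls_eq mulg1.
  by split=> [/(sgV gN)|Nx]; rewrite ?invgK //; apply: sgV.
Qed.

End Quotient.

Record grp_closed (G : grp) (P : G -> Prop) : Prop := GrpClosed {
  gc1 : P (gone G);
  gcM : forall x y, P x -> P y -> P (gmul x y);
  gcV : forall x, P x -> P (ginv x)
}.

Section SubGroupType.
Variables (G : grp) (P : G -> Prop).

Definition sub_type (_ : grp_closed P) := {x : G | P x}.
Hypothesis hP : grp_closed P.

HB.instance Definition _ := gen_eqMixin (sub_type hP).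
HB.instance Definition _ := gen_choiceMixin (sub_type hP).

Definition sub_mul (u v : sub_type hP) : sub_type hP :=
  exist _ _ (gcM hP (proj2_sig u) (proj2_sig v)).
Definition sub_one : sub_type hP := exist _ _ (gc1 hP).
Definition sub_inv (u : sub_type hP) : sub_type hP :=
  exist _ _ (gcV hP (proj2_sig u)).

Lemma sub_inj (u v : sub_type hP) : sval u = sval v -> u = v.
Proof. by case: u v => [x Px] [y Py] /= xy; apply: eq_exist. Qed.

Lemma gmulrV (x : G) : gmul x (ginv x) = gone G.
Proof.
rewrite -[LHS]gmul1 -{1}(gmulV (ginv x)) -gmulA (gmulA (ginv x)).
by rewrite gmulV gmul1 gmulV.
Qed.

Lemma gmulr1 (x : G) : gmul x (gone G) = x.
Proof. by rewrite -(gmulV x) gmulA gmulrV gmul1. Qed.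

Lemma sub_mulA : associative sub_mul.
Proof. by move=> u v w; apply: sub_inj; apply: gmulA. Qed.
Lemma sub_mul1 : left_id sub_one sub_mul.
Proof. by move=> u; apply: sub_inj; apply: gmul1. Qed.
Lemma sub_mulr1 : right_id sub_one sub_mul.
Proof. by move=> u; apply: sub_inj; apply: gmulr1. Qed.
Lemma sub_mulV : left_inverse sub_one sub_inv sub_mul.
Proof. by move=> u; apply: sub_inj; apply: gmulV. Qed.
Lemma sub_mulrV : right_inverse sub_one sub_inv sub_mul.
Proof. by move=> u; apply: sub_inj; apply: gmulrV. Qed.

HB.instance Definition _ := isGroup.Build (sub_type hP)
  sub_mulA sub_mul1 sub_mulr1 sub_mulV sub_mulrV.

Lemma subgroup_exists : exists (H : groupType) (iota : H -> G),
  [/\ injective iota, {morph iota : x y / x * y >-> gmul x y}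
    & forall x, P x <-> exists u, iota u = x].
Proof.
exists (sub_type hP), sval; split=> //; first exact: sub_inj.
move=> x; split=> [Px|[u <-]]; last exact: (proj2_sig u).
by exists (exist _ x Px).
Qed.

End SubGroupType.

Section AbelianZmod.
Variable G : groupType.
Definition zmod_type (_ : commutative (@monoid.mul G)) : Type := G.
Hypothesis cG : commutative (@monoid.mul G).
HB.instance Definition _ := Choice.copy (zmod_type cG) G.
HB.instance Definition _ := GRing.isZmodule.Build (zmod_type cG)
  (@mulgA G) cG (@mul1g G) (@mulVg G).

Lemma zmod_exists : exists (V : zmodType) (phi : G -> V),
  [/\ bijective phi & forall x y, phi (x * y) = (phi x + phi y)%R].
Proof. by exists (zmod_type cG), id; split=> //; exists id. Qed.
End AbelianZmod.

Definition grp_of (G : groupType) : grp :=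
  @Grp G (@monoid.mul G) 1 (@monoid.inv G) (@mulgA G) (@mul1g G) (@mulVg G).

(* cls is only meaningful on A. *)
Lemma abelian_section_exists (G : groupType) (A B : G -> Prop) :
  subgrp A -> subgrp B -> (forall x, B x -> A x) ->
  (forall x y, A x -> A y -> B [~ x, y]) ->
  exists (V : zmodType) (cls : G -> V),
  [/\ forall x y, A x -> A y -> cls (x * y) = (cls x + cls y)%R,
      forall v, exists2 x, A x & cls x = v
    & forall x, A x -> cls x = 0%R <-> B x].
Proof.
move=> gA gB sBA AB.
have cA : @grp_closed (grp_of G) A by split; [apply: sg1 | apply: sgM | apply: sgV].
have [H [i [i_inj iM iP]]] := subgroup_exists cA.
have iMg : {morph (i : H -> G) : x y / x * y} by [].
pose B' (u : H) := B (i u).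
have Ai u : A (i u) by apply/iP; exists u.
have hB' : subgrp B' /\ conj_closed B'.
  split; first split=> [|x y|x].
  - by rewrite /B' (morph_g1 iMg); apply: sg1.
  - by rewrite /B' iMg; apply: sgM.
  - by rewrite /B' (morph_gV iMg); apply: sgV.
  move=> x y B'x; rewrite /B' conjg_commg iMg (morph_gR iMg).
  by apply: (sgM gB) => //; apply: AB.
have [Q [pi [piM pis pik]]] := quotient_exists hB'.
have cQ : commutative (@monoid.mul Q).
  move=> u v; have [x <-] := pis u; have [y <-] := pis v.
  apply/commgP; rewrite -(morph_gR piM); apply/eqP/pik.
  by rewrite /B' (morph_gR iMg); apply: AB.
have [V [phi [[phi' phiK phiK'] phiM]]] := zmod_exists cQ.
pose inv x := if pselect (exists u, i u = x) is left e then sval (cid e) else 1.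
have invK u : inv (i u) = u.
  rewrite /inv; case: pselect => [e|[]]; last by exists u.
  by case: cid => v /= /i_inj.
exists V, (fun x => phi (pi (inv x))).
have phi1 : phi 1 = 0%R by apply: (addrI (phi 1)); rewrite -phiM mulg1 addr0.
split=> [x y /iP [u <-] /iP [v <-]|v|x /iP [u <-]].
- by rewrite -iMg !invK piM phiM.
- have [u pu] := pis (phi' v); exists (i u) => //.
  by rewrite invK pu phiK'.
- rewrite invK -phi1 -/(B' u) -pik; split=> [|->//].
  exact: (can_inj phiK).
Qed.

Local Close Scope group_scope.

(** * The Lie ring of a group *)

Local Open Scope ring_scope.

Section PowersModulo.
Local Open Scope group_scope.
Variables (G : groupType) (N : G -> Prop).
Hypotheses (gN : subgrp N) (nN : conj_closed N).

Lemma expgM_modulo x y m : N [~ x, y] -> N (x ^+ m) -> N (y ^+ m) -> N ((x * y) ^+ m).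
Proof.
have [Q [pi [piM _ pik]]] := quotient_exists (conj gN nN).
rewrite -!pik (morph_gR piM) !(morph_gX piM) piM => /eqP/commgP cxy x1 y1.
by rewrite expgMn // x1 y1 mulg1.
Qed.

End PowersModulo.

Section RootClosed.
Local Open Scope group_scope.
Variables (G : groupType) (r : nat).

(** The preimage in [gam i] of the r-primary torsion of the factor of [gam i] by [gam i.+1]. *)
Definition tor (i : nat) (x : G) := gam i x /\ exists s, gam i.+1 (x ^+ (r ^ s)).

Lemma gam_tor i x : gam i.+1 x -> tor i x.
Proof. by move=> gx; split; [apply: gamS | exists 0%N]. Qed.

Lemma tor_subgrp i : subgrp (tor i).
Proof.
split=> [|x y [gx [s hs]] [gy [t ht]]|x [gx [s hs]]].
- by apply: gam_tor; apply: (sg1 (gam_subgrp _)).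
- split; first exact: (sgM (gam_subgrp i) gx gy).
  exists (s + t)%N; have g' := @gam_subgrp G i.+1.
  apply: (expgM_modulo g' (@gam_normal _ _)).
  + exact: gam_comm.
  + by rewrite expnD expgnA; apply: sgX.
  + by rewrite addnC expnD expgnA; apply: sgX.
- split; first exact: (sgV (gam_subgrp i) gx).
  by exists s; rewrite expVgn; apply: (sgV (gam_subgrp i.+1) hs).
Qed.

Lemma tor_comm i x y : gam i x -> gam i y -> tor i [~ x, y].
Proof. by move=> gx gy; apply: gam_tor; apply: gam_comm. Qed.

Lemma tor_root i x : gam i x -> tor i (x ^+ r) -> tor i x.
Proof.
by move=> gx [_ [s hs]]; split=> //; exists s.+1; rewrite expnS expgnA.
Qed.

End RootClosed.

Arguments tor_subgrp {G} r i.

Section LieRing.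
Variables (G : groupType) (r m : nat).

Local Notation F := {ffun 'I_m -> G}.
(** Inside the direct power of G, the section of [prodA] by [prodB] is the direct sum of the first m
    factors modulo r-torsion; the Lie ring is thus a single abelian section. *)
Definition prodA (f : F) := forall i : 'I_m, gam i (f i).
Definition prodB (f : F) := forall i : 'I_m, tor r i (f i).

Lemma prodA_subgrp : subgrp prodA.
Proof.
split=> [i|f g Af Ag i|f Af i]; rewrite ffunE.
- exact: (sg1 (gam_subgrp _)).
- exact: (sgM (gam_subgrp _) (Af i) (Ag i)).
- exact: (sgV (gam_subgrp _) (Af i)).
Qed.

Lemma prodB_subgrp : subgrp prodB.
Proof.
split=> [i|f g Bf Bg i|f Bf i]; rewrite ffunE.
- exact: (sg1 (tor_subgrp _ _)).
- exact: (sgM (tor_subgrp _ _) (Bf i) (Bg i)).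
- exact: (sgV (tor_subgrp _ _) (Bf i)).
Qed.

Variables (V : zmodType) (cls : F -> V).
Hypothesis clsM : forall f g, prodA f -> prodA g -> cls (f * g)%g = cls f + cls g.
Hypothesis cls_surj : forall v, exists2 f, prodA f & cls f = v.
Hypothesis cls0 : forall f, prodA f -> cls f = 0 <-> prodB f.

Definition single (k : nat) (x : G) : F := [ffun i : 'I_m => if i == k :> nat then x else 1%g].

(* The homogeneous element of weight k represented by x; it is 0 for m <= k. *)
Definition dg (k : nat) (x : G) : V := cls (single k x).

Lemma single_prodA k x : gam k x -> prodA (single k x).
Proof. by move=> gx i; rewrite ffunE; case: eqP => [->|_] //; apply: (sg1 (gam_subgrp _)). Qed.

Lemma cls_1 : cls 1%g = 0.
Proof. by apply/cls0; [apply: (sg1 prodA_subgrp) | apply: (sg1 prodB_subgrp)]. Qed.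

Lemma clsV f : prodA f -> cls f^-1%g = - cls f.
Proof.
move=> Af; apply: (addrI (cls f)); rewrite -clsM ?mulgV ?cls_1 ?subrr //.
exact: (sgV prodA_subgrp).
Qed.

Lemma clsX f s : prodA f -> cls (f ^+ s)%g = cls f *+ s.
Proof.
move=> Af; elim: s => [|s IH]; first exact: cls_1.
by rewrite expgS mulrS clsM ?IH //; apply: (sgX _ prodA_subgrp).
Qed.

Lemma dgM k x y : gam k x -> gam k y -> dg k (x * y)%g = dg k x + dg k y.
Proof.
move=> gx gy; rewrite -clsM; [|exact: single_prodA..].
by congr cls; apply/ffunP => i; rewrite !ffunE; case: eqP => //; rewrite mulg1.
Qed.

Lemma dg1 k : dg k 1%g = 0.
Proof. by rewrite -cls_1; congr cls; apply/ffunP => i; rewrite !ffunE; case: eqP. Qed.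

Lemma dgV k x : gam k x -> dg k x^-1%g = - dg k x.
Proof.
move=> gx; apply: (addrI (dg k x)); rewrite -dgM ?mulgV ?dg1 ?subrr //.
exact: (sgV (gam_subgrp k) gx).
Qed.

Lemma dgX k x s : gam k x -> dg k (x ^+ s)%g = dg k x *+ s.
Proof.
move=> gx; elim: s => [|s IH]; first exact: dg1.
by rewrite expgS mulrS dgM ?IH //; apply: (sgX _ (gam_subgrp k) gx).
Qed.

Lemma dg_big k x : (m <= k)%N -> dg k x = 0.
Proof.
move=> mk; rewrite -cls_1; congr cls; apply/ffunP => i; rewrite !ffunE.
by case: eqP => // ik; have := ltn_ord i; lia.
Qed.

Lemma dg_tor k x : tor r k x -> dg k x = 0.
Proof.
move=> tx; apply/cls0; first by apply: single_prodA; case: tx.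
by move=> i; rewrite ffunE; case: eqP => [->|_] //; apply: (sg1 (tor_subgrp _ _)).
Qed.

Lemma dg_eq0 k x : (k < m)%N -> gam k x -> dg k x = 0 -> tor r k x.
Proof.
move=> km gx /cls0-/(_ (single_prodA gx))/(_ (Ordinal km)).
by rewrite ffunE eqxx.
Qed.

Lemma dg_gamS k x : gam k.+1 x -> dg k x = 0.
Proof. by move=> gx; apply/dg_tor/gam_tor. Qed.

Lemma dgJ k x y : gam k x -> dg k (x ^ y)%g = dg k x.
Proof.
move=> gx; have gxy := gam_comm y gx.
by rewrite conjg_commg dgM ?(dg_gamS gxy) ?addr0 //; apply: gamS.
Qed.

Lemma cls_sum f : prodA f -> cls f = \sum_(i < m) dg i (f i).
Proof.
move=> Af; pose fj j : F := [ffun i : 'I_m => if (i < j)%N then f i else 1%g].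
pose g k := if insub k is Some i then f i else 1%g.
have gE (i : 'I_m) : g i = f i by rewrite /g valK.
have gg k : gam k (g k).
  by rewrite /g; case: insubP => [i _ <-|_]; [apply: Af | apply: (sg1 (gam_subgrp k))].
have Aj j : prodA (fj j).
  by move=> i; rewrite ffunE; case: ifP => // _; apply: (sg1 (gam_subgrp _)).
have h j : cls (fj j) = \sum_(0 <= i < j) dg i (g i).
  elim: j => [|j IH].
    by rewrite big_geq // -cls_1; congr cls; apply/ffunP => i; rewrite !ffunE.
  rewrite big_nat_recr //= -IH -clsM //; last exact: single_prodA.
  congr cls; apply/ffunP => i; rewrite !ffunE ltnS leq_eqVlt.
  by case: (eqVneq (i : nat) j) => [<-|_] /=; rewrite ?ltnn ?mul1g ?gE // mulg1.
have -> : f = fj m by apply/ffunP => i; rewrite !ffunE ltn_ord.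
rewrite h big_mkord; apply: eq_bigr => i _.
by rewrite gE ffunE ltn_ord.
Qed.

Lemma dg_ind (P : V -> Prop) :
  P 0 -> (forall u v, P u -> P v -> P (u + v)) ->
  (forall k x, gam k x -> P (dg k x)) -> forall v, P v.
Proof.
move=> P0 PD Pd v; have [f Af <-] := cls_surj v; rewrite cls_sum //.
by apply: big_ind => // i _; apply: Pd.
Qed.

Lemma cls_tfree (v : V) : v *+ r = 0 -> v = 0.
Proof.
have [f Af <-] := cls_surj v; rewrite -clsX // => /cls0 h.
apply/cls0 => // i; apply: tor_root => //.
have := h (sgX _ prodA_subgrp Af) i.
suff -> : (f ^+ r)%g i = (f i ^+ r)%g by [].
by elim: {h} r => [|s IH]; rewrite ?expgS ffunE ?IH.
Qed.

Lemma cls_tfreeX s (v : V) : v *+ (r ^ s) = 0 -> v = 0.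
Proof. by elim: s => [//|s IH]; rewrite expnS mulnC mulrnA => /cls_tfree. Qed.

(** Index i stands for weight i + 1, so a bracket of indices i and j has index i + j + 1. *)
Definition dc (i j : nat) (x y : G) := dg (i + j).+1 [~ x, y]%g.

Lemma dcC i j x y : gam i x -> gam j y -> dc j i y x = - dc i j x y.
Proof.
by move=> gx gy; rewrite /dc -invgR addnC dgV //; apply: gam_commM.
Qed.

Lemma dcMl i j x x' y : gam i x -> gam i x' -> gam j y ->
  dc i j (x * x')%g y = dc i j x y + dc i j x' y.
Proof.
move=> gx gx' gy; rewrite /dc commMg dgM ?dgJ //; last exact: gam_commM.
  exact: gam_commM.
by apply: gam_normal; apply: gam_commM.
Qed.

(** This makes the bracket well defined modulo torsion: a power of r times it is the bracket of an
    element one term deeper, hence zero, and V has no r-torsion. *)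
Lemma dc_torl i j x y : tor r i x -> gam j y -> dc i j x y = 0.
Proof.
move=> [gx [s hs]] gy; apply: (@cls_tfreeX s).
have <- : dc i j (x ^+ (r ^ s))%g y = dc i j x y *+ (r ^ s).
  move: (r ^ s)%N => t; elim: t => [|t IH]; first by rewrite /dc comm1g dg1.
  by rewrite expgS mulrS dcMl ?IH //; apply: (sgX _ (gam_subgrp i) gx).
by apply: dg_gamS; rewrite -addSn; apply: gam_commM.
Qed.

Definition rp (v : V) : F := sval (cid2 (cls_surj v)).

Lemma rpA v : prodA (rp v).
Proof. by rewrite /rp; case: cid2. Qed.

Lemma rpK v : cls (rp v) = v.
Proof. by rewrite /rp; case: cid2. Qed.

Lemma rp_dcl f (i : 'I_m) j y : prodA f -> gam j y -> dc i j (rp (cls f) i) y = dc i j (f i) y.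
Proof.
move=> Af gy; pose g := ((rp (cls f))^-1 * f)%g.
have Ar := rpA (cls f).
have Arv := sgV prodA_subgrp Ar.
have Ag : prodA g by apply: (sgM prodA_subgrp Arv Af).
have Bg : prodB g.
  by apply/cls0 => //; rewrite clsM // clsV // rpK addNr.
have fE : f i = (rp (cls f) i * g i)%g by rewrite /g !ffunE mulVKg.
by rewrite fE dcMl // (dc_torl (Bg i)) // addr0.
Qed.

Lemma rp_dcr f i (j : 'I_m) x : prodA f -> gam i x -> dc i j x (rp (cls f) j) = dc i j x (f j).
Proof. by move=> Af gx; rewrite dcC ?rp_dcl -?dcC //; apply: rpA. Qed.

Definition gbr (u v : V) : V := \sum_(i < m) \sum_(j < m) dc i j (rp u i) (rp v j).

Lemma gbr_cls f g : prodA f -> prodA g ->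
  gbr (cls f) (cls g) = \sum_(i < m) \sum_(j < m) dc i j (f i) (g j).
Proof.
move=> Af Ag; apply: eq_bigr => i _; apply: eq_bigr => j _.
by rewrite rp_dcl ?rp_dcr //; apply: rpA.
Qed.

Lemma gbrDl u u' v : gbr (u + u') v = gbr u v + gbr u' v.
Proof.
rewrite -[u]rpK -[u']rpK -[v]rpK -clsM; try exact: rpA.
rewrite !gbr_cls; try exact: rpA; last exact: (sgM prodA_subgrp (rpA u) (rpA u')).
rewrite -big_split; apply: eq_bigr => i _; rewrite -big_split; apply: eq_bigr => j _.
by rewrite ffunE dcMl //; apply: rpA.
Qed.

Lemma gbrC u v : gbr u v = - gbr v u.
Proof.
rewrite /gbr exchange_big -sumrN; apply: eq_bigr => i _.
rewrite -sumrN; apply: eq_bigr => j _; rewrite -dcC //; exact: rpA.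
Qed.

Lemma gbrDr u v v' : gbr u (v + v') = gbr u v + gbr u v'.
Proof. by rewrite gbrC gbrDl opprD -!gbrC. Qed.

Lemma gbr0l v : gbr 0 v = 0.
Proof. by apply: (addrI (gbr 0 v)); rewrite -gbrDl !addr0. Qed.

Lemma gbrNl u v : gbr (- u) v = - gbr u v.
Proof. by apply: (addrI (gbr u v)); rewrite -gbrDl !subrr gbr0l. Qed.

Lemma gbr0r v : gbr v 0 = 0.
Proof. by rewrite gbrC gbr0l oppr0. Qed.

Lemma gbr_dg i j x y : gam i x -> gam j y -> gbr (dg i x) (dg j y) = dc i j x y.
Proof.
move=> gx gy; have [mi|im] := leqP m i.
  by rewrite dg_big // gbr0l /dc dg_big //; lia.
have [mj|jm] := leqP m j.
  by rewrite [dg j y]dg_big // gbr0r /dc dg_big //; lia.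
rewrite gbr_cls; [|exact: single_prodA..].
rewrite (bigD1 (Ordinal im)) //= [X in _ + X]big1 ?addr0 => [|k ki]; last first.
  rewrite big1 // => l _; rewrite ffunE -(inj_eq val_inj) /= in ki *.
  by rewrite (negPf ki) /dc comm1g dg1.
rewrite (bigD1 (Ordinal jm)) //= big1 ?addr0 => [|l lj]; last first.
  rewrite [single j y _]ffunE -(inj_eq val_inj) /= in lj *.
  by rewrite (negPf lj) /dc commg1 dg1.
by rewrite !ffunE !eqxx.
Qed.

Lemma gbr_gbr_dg i j k x y z : gam i x -> gam j y -> gam k z ->
  gbr (gbr (dg i x) (dg j y)) (dg k z) = dg (i + j + k).+2 [~ x, y, z]%g.
Proof.
by move=> gx gy gz; rewrite gbr_dg // gbr_dg //; apply: gam_commM.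
Qed.

(** By additivity the Jacobi identity reduces to homogeneous elements, where it is the Hall-Witt
    identity: conjugation is invisible in a single factor, and each inverse contributes the same
    sign. *)
Lemma gbr_lie : lie_bracket gbr.
Proof.
split; [exact: gbrDl|by move=> x y z; apply: gbrDr|exact: gbrC|].
move=> u v w.
have E (a a' b b' c c' : V) :
    a + b + c = 0 -> a' + b' + c' = 0 -> (a + a') + (b + b') + (c + c') = 0.
  by move=> h h'; rewrite [a + a' + _]addrACA [LHS]addrACA h h' addr0.
elim/dg_ind: u => [|u u' IH IH'|i x gx].
- by rewrite !(gbr0l, gbr0r) !addr0.
- by rewrite !(gbrDl, gbrDr); apply: E.
elim/dg_ind: v => [|v v' IH IH'|j y gy].
- by rewrite !(gbr0l, gbr0r) !addr0.
- by rewrite !(gbrDl, gbrDr); apply: E.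
elim/dg_ind: w => [|w w' IH IH'|k z gz].
- by rewrite !(gbr0l, gbr0r) !addr0.
- by rewrite !(gbrDl, gbrDr); apply: E.
have gVx : gam i x^-1%g := sgV (gam_subgrp i) gx.
have gVy : gam j y^-1%g := sgV (gam_subgrp j) gy.
have gVz : gam k z^-1%g := sgV (gam_subgrp k) gz.
have := congr1 (dg (i + j + k).+2) (hall_witt x y z).
have e2 : (j + k + i = i + j + k)%N by lia.
have e3 : (k + i + j = i + j + k)%N by lia.
have g1 : gam (i + j + k).+2 [~ x, y^-1, z]%g.
  by rewrite -addSn; apply: gam_commM => //; apply: gam_commM.
have g2 : gam (i + j + k).+2 [~ y, z^-1, x]%g.
  by rewrite -e2 -addSn; apply: gam_commM => //; apply: gam_commM.
have g3 : gam (i + j + k).+2 [~ z, x^-1, y]%g.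
  by rewrite -e3 -addSn; apply: gam_commM => //; apply: gam_commM.
have gK := @gam_subgrp G (i + j + k).+2.
have gJ1 := gam_normal _ _ y g1; have gJ2 := gam_normal _ _ z g2.
have gJ3 := gam_normal _ _ x g3.
rewrite dg1 dgM //; last exact: (sgM gK).
rewrite dgM // !dgJ //.
rewrite -{1}(gbr_gbr_dg gx gVy gz) -{1}e2 -(gbr_gbr_dg gy gVz gx).
rewrite -{1}e3 -(gbr_gbr_dg gz gVx gy) !dgV //.
have NN u v w : gbr (gbr u (- v)) w = - gbr (gbr u v) w.
  by rewrite -gbrNl; congr gbr; rewrite gbrC gbrNl (gbrC u v).
by rewrite !NN -!opprD => /eqP; rewrite oppr_eq0 => /eqP.
Qed.

Section Endomorphism.
Variable a : G -> G.
Hypothesis aM : {morph a : x y / (x * y)%g}.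

Lemma tor_morph i x : tor r i x -> tor r i (a x).
Proof.
move=> [gx [s hs]]; split; first exact: morph_gam.
by exists s; rewrite -(morph_gX aM); apply: morph_gam.
Qed.

Definition mapF (f : F) : F := [ffun i => a (f i)].

Lemma mapF_A f : prodA f -> prodA (mapF f).
Proof. by move=> Af i; rewrite ffunE; apply: morph_gam. Qed.

Lemma mapF_B f : prodB f -> prodB (mapF f).
Proof. by move=> Bf i; rewrite ffunE; apply: tor_morph. Qed.

Lemma mapFM f g : mapF (f * g)%g = (mapF f * mapF g)%g.
Proof. by apply/ffunP => i; rewrite !ffunE aM. Qed.

Definition lie_map (v : V) : V := cls (mapF (rp v)).

Lemma lie_map_cls f : prodA f -> lie_map (cls f) = cls (mapF f).
Proof.
move=> Af; pose g := ((rp (cls f))^-1 * f)%g.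
have Ar := rpA (cls f).
have Arv := sgV prodA_subgrp Ar.
have Ag : prodA g by apply: (sgM prodA_subgrp Arv Af).
have Bg : prodB g.
  by apply/cls0 => //; rewrite clsM // clsV // rpK addNr.
have fE : f = (rp (cls f) * g)%g by rewrite /g mulVKg.
rewrite {2}fE mapFM clsM; [|exact: mapF_A..].
have /cls0 -> := mapF_B Bg; first by rewrite addr0.
exact: mapF_A.
Qed.

Lemma lie_map_dg k x : gam k x -> lie_map (dg k x) = dg k (a x).
Proof.
move=> gx; rewrite lie_map_cls; last exact: single_prodA.
congr cls; apply/ffunP => i; rewrite !ffunE; case: eqP => // _.
exact: morph_g1.
Qed.

Lemma lie_mapD : {morph lie_map : u v / u + v}.
Proof.
move=> u v; rewrite -[u]rpK -[v]rpK -clsM; try exact: rpA.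
rewrite !lie_map_cls; try exact: rpA; last exact: (sgM prodA_subgrp (rpA u) (rpA v)).
by rewrite mapFM clsM //; apply: mapF_A; apply: rpA.
Qed.

Lemma lie_map0 : lie_map 0 = 0.
Proof. by apply: (addrI (lie_map 0)); rewrite -lie_mapD !addr0. Qed.

Lemma lie_map_br : {morph lie_map : u v / gbr u v}.
Proof.
move=> u v; elim/dg_ind: u => [|u u' IH IH'|i x gx].
- by rewrite !gbr0l lie_map0 gbr0l.
- by rewrite lie_mapD !gbrDl lie_mapD IH IH'.
elim/dg_ind: v => [|v v' IH IH'|j y gy].
- by rewrite !gbr0r lie_map0 gbr0r.
- by rewrite lie_mapD !gbrDr lie_mapD IH IH'.
rewrite gbr_dg // /dc !lie_map_dg //; last exact: gam_commM.
by rewrite gbr_dg ?(morph_gR aM) //; apply: morph_gam.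
Qed.

Lemma iter_lie_map_dg j k x : gam k x ->
  iter j lie_map (dg k x) = dg k (iter j a x) /\ gam k (iter j a x).
Proof.
move=> gx; elim: j => //= j [-> gj]; split; last exact: morph_gam.
exact: lie_map_dg.
Qed.

End Endomorphism.

(** The Lie ring is generated by its component of index 0, as each term of the lower central series
    consists of products of commutators with the previous one. *)
Lemma dg_leftnormed k z : gam k z ->
  span (fun v => exists x ys, size ys = k /\ v = leftnormed gbr x ys) (dg k z).
Proof.
elim: k z => [|k IH] z /= gz; first by apply: span_in; exists (dg 0 z), [::].
have : gam k.+1 z /\
    span (fun v => exists x ys, size ys = k.+1 /\ v = leftnormed gbr x ys) (dg k.+1 z).
  elim: gz => [|_ [x [y [gx ->]]]|x y _ [gx IHx] _ [gy IHy]|x _ [gx IHx]].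
  - by rewrite dg1; split; [apply: genp1 | apply: span0].
  - split; first exact: gam_comm.
    have -> : dg k.+1 [~ x, y]%g = gbr (dg k x) (dg 0 y) by rewrite gbr_dg // /dc addn0.
    elim: (IH x gx) => [|_ [u [us [su ->]]]|u v _ IHu _ IHv].
    + by rewrite gbr0l; apply: span0.
    + apply: span_in; exists u, (rcons us (dg 0 y)).
      by rewrite size_rcons su /leftnormed foldl_rcons.
    + by rewrite gbrDl gbrNl; apply: spanB.
  - by rewrite dgM //; split; [apply: genpM | apply: spanD].
  - by rewrite dgV //; split; [apply: genpV | apply: spanN].
by case.
Qed.

End LieRing.

(** * Integer polynomials in an additive map, and cyclotomic factors *)

Section PolyAction.
Variables (V : zmodType) (t : V -> V).
Hypothesis tD : {morph t : u v / u + v}.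

Let t0 : t 0 = 0.
Proof. by apply: (addrI (t 0)); rewrite -tD !addr0. Qed.

Let tN : {morph t : v / - v}.
Proof. by move=> v; apply: (addrI (t v)); rewrite -tD !subrr t0. Qed.

Lemma iter_morphMz j v z : iter j t (v *~ z) = iter j t v *~ z.
Proof.
have tMn u s : t (u *+ s) = t u *+ s.
  by elim: s => [|s IH]; rewrite ?mulr0n // !mulrS tD IH.
elim: j => //= j ->; case: z => s; first by rewrite -!pmulrn tMn.
by rewrite !NegzE !mulrNz -!pmulrn tN tMn.
Qed.

Definition pact (p : {poly int}) (v : V) : V :=
  \sum_(j < size p) iter j t v *~ p`_j.

Lemma pact_big N (p : {poly int}) v : (size p <= N)%N ->
  pact p v = \sum_(j < N) iter j t v *~ p`_j.
Proof.
move=> pN; rewrite /pact -!(big_mkord xpredT (fun j => iter j t v *~ p`_j)).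
rewrite [RHS](big_cat_nat (n := size p)) //= [X in _ = _ + X]big_nat_cond.
rewrite [X in _ = _ + X]big1 ?addr0 //.
by move=> j /andP [/andP [pj _] _]; rewrite nth_default // mulr0z.
Qed.

Lemma pactD p q v : pact (p + q) v = pact p v + pact q v.
Proof.
pose N := maxn (size p) (size q).
rewrite !(@pact_big N) ?leq_maxl ?leq_maxr ?size_polyD // -big_split.
by apply: eq_bigr => j _; rewrite coefD mulrzDr.
Qed.

Lemma pact0 v : pact 0 v = 0.
Proof. by rewrite /pact size_poly0 big_ord0. Qed.

Lemma pactC c p v : pact (c%:P * p) v = pact p v *~ c.
Proof.
rewrite (@pact_big (size p)); last by rewrite mul_polyC size_scale_leq.
rewrite /pact mulrz_suml; apply: eq_bigr => j _.
by rewrite coefCM mulrC mulrzA.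
Qed.

Lemma pactXr p v : pact (p * 'X) v = t (pact p v).
Proof.
rewrite (@pact_big (size p).+1); last first.
  by apply: leq_trans (size_polyMleq _ _) _; rewrite size_polyX addn2.
rewrite big_ord_recl coefMX mulr0z add0r /pact (big_morph t tD t0).
by apply: eq_bigr => j _; rewrite coefMX /= -(iter_morphMz 1).
Qed.

Lemma pactXn j v : pact 'X^j v = iter j t v.
Proof.
elim: j => [|j IH]; last by rewrite exprSr pactXr IH.
by rewrite expr0 /pact size_poly1 big_ord_recl big_ord0 addr0 coef1.
Qed.

Lemma pact_sum I (s : seq I) (f : I -> {poly int}) v :
  pact (\sum_(i <- s) f i) v = \sum_(i <- s) pact (f i) v.
Proof.
apply: (big_morph (fun p => pact p v)) => [p q|]; first exact: pactD.
exact: pact0.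
Qed.

Lemma pact_mul p q : (forall v, pact p v = 0) -> forall v, pact (q * p) v = 0.
Proof.
move=> p0; elim/poly_ind: q => [|q c IH] v; first by rewrite mul0r pact0.
by rewrite mulrDl pactD pactC p0 mul0rz addr0 mulrAC pactXr IH t0.
Qed.

End PolyAction.

(** With d = n/r, the sum times X^d - 1 is X^n - 1. Phi_n is a factor of X^n - 1 that does not occur
    in X^d - 1, so it survives when X^d - 1 is cancelled. *)
Lemma Cyclotomic_dvd_trace n r : (0 < n)%N -> prime r -> (r %| n)%N ->
  exists q : {poly int}, \sum_(k < r) 'X^(k * (n %/ r)) = q * 'Phi_n.
Proof.
move=> n0 r_pr rn; have r0 := prime_gt0 r_pr.
set d := (n %/ r)%N; have dn : (d * r = n)%N by rewrite divnK.
have d0 : (0 < d)%N by rewrite divn_gt0 // dvdn_leq.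
have ndd : n \notin divisors d.
  rewrite -dvdn_divisors //; apply/negP => /(dvdn_leq d0).
  by rewrite -dn; have := prime_gt1 r_pr; nia.
have sdn : {subset divisors d <= divisors n}.
  move=> e; rewrite -!dvdn_divisors // => ed; apply: dvdn_trans ed _.
  by rewrite -dn dvdn_mulr.
exists (\prod_(e <- rem n (divisors n) | e \notin divisors d) 'Phi_e).
apply: (@mulfI _ ('X^d - 1)).
  by rewrite -size_poly_gt0 size_XnsubC.
have -> : ('X^d - 1) * \sum_(k < r) 'X^(k * d) = 'X^n - 1 :> {poly int}.
  rewrite -dn exprM [RHS]subrX1; congr (_ * _).
  by apply: eq_bigr => k _; rewrite mulnC exprM.
rewrite -(prod_Cyclotomic n0) -(prod_Cyclotomic d0).
have nn : n \in divisors n by rewrite -dvdn_divisors.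
rewrite (perm_big _ (perm_to_rem nn)) big_cons /= [RHS]mulrA [RHS]mulrC.
congr (_ * _).
rewrite (bigID (fun e => e \in divisors d)) /=; congr (_ * _).
rewrite -big_filter; apply: perm_big; apply: uniq_perm.
- by rewrite filter_uniq // rem_uniq // divisors_uniq.
- exact: divisors_uniq.
move=> e; rewrite mem_filter mem_rem_uniq ?divisors_uniq // !inE.
have [ed|//] := boolP (e \in divisors d); rewrite /= sdn // andbT.
by apply: contraNneq ndd => <-.
Qed.

(** * Torsion of the lower central factors *)

Section CyclotomicTorsion.
Variables (G : groupType) (a : G -> G) (n r : nat).
Hypothesis aM : {morph a : x y / (x * y)%g}.
Hypothesis cyc : cyclotomic_map (@monoid.mul G) 1%g (@monoid.inv G) n a.
Hypotheses (n0 : (0 < n)%N) (r_pr : prime r) (rn : (r %| n)%N).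

Theorem gam_torsion c (z : G) : (r.-1 ^ (2 ^ r.-1) <= c)%N -> gam c z ->
  exists s, gam c.+1 (z ^+ (r ^ s))%g.
Proof.
move=> hc gz.
(* Keeping c + 1 components makes index c, where z is represented, the last one retained. *)
have AB (f g : {ffun 'I_c.+1 -> G}) : prodA f -> prodA g -> prodB r [~ f, g]%g.
  move=> Af Ag i; have -> : [~ f, g]%g i = [~ f i, g i]%g by rewrite !ffunE.
  exact: tor_comm.
have BA (f : {ffun 'I_c.+1 -> G}) : prodB r f -> prodA f by move=> Bf i; case: (Bf i).
have [V [cls [clsM cls_surj cls0]]] :=
  abelian_section_exists (@prodA_subgrp G c.+1) (@prodB_subgrp G r c.+1) BA AB.
have LB := gbr_lie clsM cls_surj cls0.
pose t := lie_map cls_surj a.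
have tD : {morph t : u v / u + v} by exact: (lie_mapD clsM cls_surj cls0 aM).
have t_br : {morph t : u v / gbr cls_surj u v} by exact: (lie_map_br clsM cls_surj cls0 aM).
have dg_word k x : gam k x -> pact t 'Phi_n (dg cls k x) = 0.
  move=> gx.
  have zpow w : dg cls k (zpow_gen (@monoid.mul G) 1%g (@monoid.inv G) x w) = dg cls k x *~ w
      /\ gam k (zpow_gen (@monoid.mul G) 1%g (@monoid.inv G) x w).
    case: w => s; rewrite /zpow_gen iter_mulg_1.
      by split; [rewrite (dgX clsM cls0) // | apply: (sgX _ (gam_subgrp k))].
    have gs : gam k (x ^+ s.+1)%g by apply: (sgX _ (gam_subgrp k)).
    rewrite (dgV clsM cls0) // (dgX clsM cls0) // NegzE mulrNz -pmulrn.
    by split=> //; apply: (sgV (gam_subgrp k)).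
  have h (s : seq nat) (T := foldr (fun i acc => (iter i a (zpow_gen (@monoid.mul G) 1%g
      (@monoid.inv G) x ('Phi_n)`_i)%R * acc)%g) 1%g s) :
      gam k T /\ dg cls k T = \sum_(j <- s) iter j t (dg cls k x) *~ ('Phi_n)`_j.
    rewrite {}/T; elim: s => [|j s [gT IH]] /=.
      by rewrite big_nil (dg1 cls0); split=> //; apply: (sg1 (gam_subgrp k)).
    have [e1 g1] := zpow ('Phi_n)`_j.
    have [e2 g2] := iter_lie_map_dg clsM cls_surj cls0 aM j g1.
    rewrite big_cons -IH -(iter_morphMz tD) -e1 e2 (dgM clsM) //; split=> //.
    exact: (sgM (gam_subgrp k)).
  have [_] := h (iota 0 (size 'Phi_n)).
  rewrite -[foldr _ _ _]/(cyclo_word _ _ _ n a x) cyc (dg1 cls0) => ->.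
  rewrite /pact -(big_mkord xpredT (fun j => iter j t (dg cls k x) *~ ('Phi_n)`_j)).
  by rewrite /index_iota subn0.
have pactPhi v : pact t 'Phi_n v = 0.
  have pD u w : pact t 'Phi_n (u + w) = pact t 'Phi_n u + pact t 'Phi_n w.
    have iD j u' w' : iter j t (u' + w') = iter j t u' + iter j t w'.
      by elim: j => //= j ->; rewrite tD.
    by rewrite /pact -big_split; apply: eq_bigr => j _; rewrite iD mulrzDl.
  elim/(dg_ind clsM cls_surj cls0): v => [|u w hu hw|k x gx]; last exact: dg_word.
    by apply: (addrI (pact t 'Phi_n 0)); rewrite -pD !addr0.
  by rewrite pD hu hw addr0.
pose beta v := iter (n %/ r) t v.
have betaD : {morph beta : u v / u + v}.
  by move=> u v; rewrite /beta; elim: (n %/ r)%N => //= j ->; rewrite tD.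
have beta_br : {morph beta : u v / gbr cls_surj u v}.
  by move=> u v; rewrite /beta; elim: (n %/ r)%N => //= j ->; rewrite t_br.
have beta_sum v : \sum_(k < r) iter k beta v = 0.
  have [q qE] := Cyclotomic_dvd_trace n0 r_pr rn.
  have := pact_mul tD q pactPhi v; rewrite -qE pact_sum => h.
  rewrite -[RHS]h; apply: eq_bigr => k _; rewrite (pactXn tD).
  by elim: (nat_of_ord k) => //= j ->; rewrite /beta mulSn iterD.
have := dg_leftnormed clsM cls_surj cls0 gz => dz.
have : dg cls c z = 0.
  elim: dz => [//|_ [x [ys [sy ->]]]|u w _ -> _ ->]; last exact: subrr.
  apply: (higman_automorphism LB r_pr betaD beta_br beta_sum); last by rewrite sy.
  by move=> v; apply: (cls_tfree clsM cls_surj cls0).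
by case/(dg_eq0 cls0 (ltnSn c) gz).
Qed.

End CyclotomicTorsion.

Local Close Scope ring_scope.

(** * Finitely generated nilpotent groups *)

Local Open Scope group_scope.

Lemma sg_gcdn (G : groupType) (P : G -> Prop) x m n :
  subgrp P -> P (x ^+ m) -> P (x ^+ n) -> P (x ^+ gcdn m n).
Proof.
move=> gP Pm Pn; have [->|m0] := posnP m; first by rewrite gcd0n.
case: (egcdnP n m0) => km kn e _.
apply: (@sgMl _ P (x ^+ (kn * n))) => //.
  by rewrite mulnC expgnA; apply: sgX.
by rewrite -expgnDr -e mulnC expgnA; apply: sgX.
Qed.

Section CentralSeries.
Variable G : groupType.
Implicit Types (x y : G) (l S : seq G).

Definition genl l := genp (fun y : G => y \in l).

Lemma genl_nil x : genl [::] x -> x = 1.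
Proof. by elim=> [|y|y z _ -> _ ->|y _ ->] //; rewrite ?mulg1 ?invg1. Qed.

Lemma genl_sub l l' : {subset l <= l'} -> forall x, genl l x -> genl l' x.
Proof. by move=> sl; apply: genp_mono => y /sl. Qed.

(* The tails of l generate a central series with cyclic factors. *)
Fixpoint pc l : Prop :=
  if l is x :: l' then (forall h, genl l' [~ x, h]) /\ pc l' else True.

Lemma pc_normal l : pc l -> conj_closed (genl l).
Proof.
elim: l => [_ x y /genl_nil ->|x l IH [xl pl]] /=.
  by rewrite conj1g; apply: genp1.
have sl : forall y, genl l y -> genl (x :: l) y.
  by apply: genl_sub => y yl; rewrite inE yl orbT.
apply: genp_normal => y h; rewrite inE => /orP [/eqP ->|yl].
  rewrite conjg_commg; apply: genpM; last exact/sl/xl.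
  by apply: genp_in; rewrite inE eqxx.
by apply: sl; apply: (IH pl); apply: genp_in.
Qed.

(** In the quotient by the tail, x is central and its powers exhaust the image. Two natural
    exponents i, j replace the integer exponent j - i. *)
Lemma pc_cons x l : pc (x :: l) -> exists (Q : groupType) (pi : G -> Q),
  [/\ {morph pi : x y / x * y}, forall y, pi y = 1 <-> genl l y,
      forall y, pi x * pi y = pi y * pi x
    & forall y, genl (x :: l) y -> exists i j, pi y * pi x ^+ i = pi x ^+ j].
Proof.
move=> [xl pl].
have [Q [pi [piM pis pik]]] := quotient_exists (conj (genp_subgrp _) (pc_normal pl)).
exists Q, pi; split=> // [y|y].
  by apply/commgP; rewrite -(morph_gR piM); apply/eqP/pik/xl.
elim=> [|z|z t _ [i [j e]] _ [i' [j' e']]|z _ [i [j e]]].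
- by exists 0%N, 0%N; rewrite (morph_g1 piM) mulg1.
- rewrite inE => /orP [/eqP ->|zl]; first by exists 0%N, 1%N; rewrite mulg1.
  by exists 0%N, 0%N; have -> : pi z = 1 by [apply/pik/genp_in]; rewrite mulg1.
- exists (i + i')%N, (j + j')%N; rewrite piM [(i + i')%N]addnC expgnDr mulgA.
  by rewrite -(mulgA (pi z)) e' -mulgA -expgnDr addnC expgnDr mulgA e -expgnDr.
- exists j, i; rewrite -e (morph_gV piM) mulKg //.
Qed.

(** If x has finite order modulo the tail, that order multiplies the exponent found for the tail;
    otherwise a torsion element already lies in the tail. *)
Lemma pc_torsion l : pc l -> exists2 M, (0 < M)%N &
  forall y t, genl l y -> (0 < t)%N -> y ^+ t = 1 -> y ^+ M = 1.
Proof.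
elim: l => [_|x l IH pxl]; first by exists 1%N => // y t /genl_nil ->.
have [M0 M0p hM0] := IH (proj2 pxl).
have [Q [pi [piM pik pic pig]]] := pc_cons pxl.
have [[M Mp xM]|nM] := pselect (exists2 M, (0 < M)%N & pi x ^+ M = 1).
  exists (M * M0)%N; first by rewrite muln_gt0 Mp.
  move=> y t yl tp yt; rewrite expgnA; apply: (hM0 _ t) => //; last first.
    by rewrite expgnAC yt expg1n.
  apply/pik; rewrite (morph_gX piM).
  have [i [j e]] := pig y yl.
  have -> : pi y = pi x ^+ j * (pi x ^+ i)^-1 by rewrite -e mulgK.
  rewrite expgnFl; last by apply: commuteX2.
  by rewrite -!expgnA mulnC expgnA xM expg1n mulnC expgnA xM expg1n invg1 mulg1.
exists M0 => // y t yl tp yt; apply: (hM0 _ t) => //; apply/pik.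
have [i [j e]] := pig y yl.
have e2 : pi x ^+ (i * t) = pi x ^+ (j * t).
  rewrite (expgnA _ j) -e expgMn; last by apply/commuteX/commute_sym/pic.
  by rewrite -(morph_gX piM t y) yt (morph_g1 piM) mul1g expgnA.
have ij : i = j.
  apply/eqP; apply/negPn/negP => nij; apply: nM.
  have [lij|lji] := leqP i j.
    exists (j * t - i * t)%N; first by rewrite -mulnBl muln_gt0 tp andbT; lia.
    by rewrite expgnFr ?leq_mul2r ?lij ?orbT // e2 mulgV.
  exists (i * t - j * t)%N; first by rewrite -mulnBl muln_gt0 tp andbT; lia.
  by rewrite expgnFr ?leq_mul2r ?(ltnW lji) ?orbT // e2 mulgV.
by apply: (mulIg (pi x ^+ i)); rewrite e ij mul1g.
Qed.

Lemma pc_finite l M : pc l -> (0 < M)%N -> (forall y : G, y ^+ M = 1) ->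
  exists s : seq G, forall y, genl l y -> y \in s.
Proof.
move=> + Mp hM; elim: l => [_|x l IH pxl].
  by exists [:: 1] => y /genl_nil ->; rewrite inE.
have [s hs] := IH (proj2 pxl).
have [Q [pi [piM pik pic pig]]] := pc_cons pxl.
exists [seq x ^+ k * u | k <- iota 0 M, u <- s] => y yl.
have [i [j e]] := pig y yl.
(* Modulo M this is j - i, written without subtraction. *)
pose k := ((j + M.-1 * i) %% M)%N.
have xk : x ^+ k = x ^+ (j + M.-1 * i).
  by rewrite [in RHS](divn_eq (j + M.-1 * i) M) expgnDr mulnC expgnA hM expg1n mul1g.
have xi : x ^+ i * x ^+ (M.-1 * i) = 1.
  by rewrite -expgnDr -mulSn prednK // expgnA hM expg1n.
have yE : y = x ^+ k * ((x ^+ k)^-1 * y) by rewrite mulVKg.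
rewrite yE; apply/allpairsP; exists (k, (x ^+ k)^-1 * y); split=> //=.
  by rewrite mem_iota /= ltn_mod.
apply: hs; apply/pik; rewrite piM (morph_gV piM); apply: (mulgI (pi (x ^+ k))).
rewrite mulVKg mulg1 xk expgnDr piM !(morph_gX piM) -e -mulgA.
by rewrite -!(morph_gX piM) -piM xi (morph_g1 piM) mulg1.
Qed.

(** The list collects the left-normed commutators [W i] in the generators, deepest first.
    Commutators of [W i] with generators lie in [W i.+1]; normality of the tail extends this to
    commutators with all of G. *)
Lemma pc_exists S c : (forall x, genl S x) -> (forall x : G, gam c x -> x = 1) ->
  exists2 l, pc l & forall x, genl l x.
Proof.
move=> genS nil.
pose W := fix W i := if i is i'.+1 then [seq [~ x, y] | x <- W i', y <- S] else S.
have Wg i x : x \in W i -> gam i x.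
  elim: i x => //= i IH x /allpairsP [[u v] /= [/IH gu _ ->]].
  exact: gam_comm.
have h d i : (i + d = c)%N -> exists2 l, pc l & forall x, x \in W i -> genl l x.
  elim: d i => [|d IH] i.
    rewrite addn0 => ->; exists [::] => // x /Wg/nil ->; exact: genp1.
  rewrite addnS -addSn => /IH [l pl Wl].
  have [|l' [pl' sl' Wl']] := (_ : exists l', [/\ pc l',
      forall x, genl l x -> genl l' x & forall x, x \in W i -> genl l' x]); last by exists l'.
  have : {subset W i <= W i} by [].
  elim: {1 3}(W i) => [|x w IHw] sw; first by exists l; split.
  have [|l' [pl' sl' Wl']] := IHw; first by move=> y yw; apply: sw; rewrite inE yw orbT.
  have sl2 : forall y, genl l' y -> genl (x :: l') y.
    by apply: genl_sub => y yl; rewrite inE yl orbT.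
  exists (x :: l'); split=> [|y /sl'/sl2 //|y].
    split=> // y; move: y (genS y).
    apply: (@genp_min _ _ (fun y => genl l' [~ x, y])).
      by apply: commr_subgrp; [apply: genp_subgrp | apply: pc_normal].
    move=> y yS; apply/sl'/Wl => /=; apply/allpairsP.
    by exists (x, y); split=> //=; apply: sw; rewrite inE eqxx.
  rewrite inE => /orP [/eqP ->|/Wl'/sl2 //].
  by apply: genp_in; rewrite inE eqxx.
have [l pl Sl] := h c 0%N erefl; exists l => // x; move: (genS x).
by apply: genp_min; [apply: genp_subgrp | apply: Sl].
Qed.

Fixpoint zeta (i : nat) (x : G) : Prop :=
  if i is i'.+1 then forall y, zeta i' [~ x, y] else x = 1.

Lemma zeta_normal i : subgrp (zeta i) /\ conj_closed (zeta i).
Proof.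
elim: i => [|i [gi ni]] /=.
  split; first by split=> [|x y -> ->|x ->]; rewrite ?mulg1 ?invg1.
  by move=> x y ->; rewrite conj1g.
split; first split=> [y|x z zx zz y|x zx y].
- by rewrite comm1g; apply: sg1.
- by apply: (sgM (comml_subgrp y gi ni)).
- by apply: (sgV (comml_subgrp y gi ni)).
move=> x y zx z; rewrite -(conjgKV y z) -conjRg; exact: ni.
Qed.

Lemma gam_zeta c i x : (forall x : G, gam c x -> x = 1) -> (i <= c)%N ->
  gam (c - i) x -> zeta i x.
Proof.
move=> nil; elim: i x => [|i IH] x ic; first by rewrite subn0 => /nil.
move=> gx y; apply: IH; first exact: ltnW.
by rewrite -(subnSK ic); apply: gam_comm.
Qed.

(** If x lies in the term i + 2, then [x, y] is central modulo the term i, so [x^M, y] agrees there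
    with [x, y]^M, which the induction hypothesis kills. *)
Lemma zeta_exponent M i x : (forall x, zeta 1 x -> x ^+ M = 1) ->
  zeta i.+1 x -> zeta i (x ^+ M).
Proof.
move=> hM; elim: i x => [|i IH] x zx; first exact: hM.
move=> y; have zxy : zeta i.+1 [~ x, y] := zx y.
have [Q [pi [piM pis pik]]] := quotient_exists (zeta_normal i).
apply/pik; rewrite (morph_gR piM) (morph_gX piM).
have cent v : pi [~ x, y] ^ v = pi [~ x, y].
  have [w <-] := pis v; apply/conjg_fixP; rewrite -(morph_gR piM).
  exact/eqP/pik/zxy.
have -> k : [~ pi x ^+ k, pi y] = pi [~ x, y] ^+ k.
  elim: k => [|k IHk]; first by rewrite comm1g.
  by rewrite !expgS commMg IHk -(morph_gR piM) cent.
rewrite -(morph_gX piM); apply/pik; exact: IH.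
Qed.

Lemma nil_exponent M c : (forall x : G, gam c x -> x = 1) ->
  (forall x, zeta 1 x -> x ^+ M = 1) -> forall x : G, x ^+ (M ^ c) = 1.
Proof.
move=> nil hM x.
have : zeta c x by apply: (gam_zeta nil) => //; rewrite subnn.
elim: c {nil} x => [|c IH] x zx; first by rewrite expn0 expg1.
by rewrite expnS expgnA IH //; apply: zeta_exponent.
Qed.

(** Once two consecutive terms agree the series is constant from there on, so nilpotency of any
    class e makes them trivial. *)
Lemma gam_stable c e : (forall z : G, gam c z -> gam c.+1 z) ->
  (forall z : G, gam e z -> z = 1) -> forall z : G, gam c z -> z = 1.
Proof.
move=> st nil z gz; apply: nil.
have h k : gam (c + k) z; last by apply: (gam_le (leq_addl c e)); apply: h.
suff st' j (y : G) : gam (c + j) y -> gam (c + j).+1 y.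
  by elim: k => [|k IH]; rewrite ?addn0 // addnS; apply: st'.
elim: j y => [|j IH] y; first by rewrite addn0; apply: st.
rewrite addnS; apply: genp_mono => _ [u [v [gu ->]]].
by exists u, v; split=> //; apply: IH.
Qed.

End CentralSeries.

Section FiniteGroup.
Variables (G : groupType) (s : seq G).
Definition fin_type (_ : forall x, x \in s) : Type := G.
Hypothesis hs : forall x, x \in s.
HB.instance Definition _ := Group.copy (fin_type hs) G.

Lemma fin_pickleK : pcancel (fun x : fin_type hs => index x s)
  (fun k => Some (nth 1 s k : fin_type hs)).
Proof. by move=> x; rewrite nth_index. Qed.

HB.instance Definition _ := PCanIsCountable fin_pickleK.

Lemma fin_enumP : Finite.axiom (undup s : seq (fin_type hs)).
Proof.
by apply: Finite.uniq_enumP => [|x]; rewrite ?undup_uniq // mem_undup inE hs.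
Qed.

HB.instance Definition _ := isFinite.Build (fin_type hs) fin_enumP.

Lemma fin_exists : exists (gT : finGroupType) (phi : G -> gT),
  bijective phi /\ {morph phi : x y / x * y}.
Proof. by exists (fin_type hs), id; split=> //; exists id. Qed.
End FiniteGroup.

(** * Cyclotomic words *)

Notation cycg n a := (cyclotomic_map (@monoid.mul _) 1 (@monoid.inv _) n a).

Lemma cyclo_word_morph (T U : Type) mulT oneT invT mulU oneU invU
    (f : T -> U) (a : T -> T) (b : U -> U) n x :
  f oneT = oneU -> {morph f : x y / mulT x y >-> mulU x y} ->
  {morph f : x / invT x >-> invU x} -> (forall x, f (a x) = b (f x)) ->
  f (cyclo_word mulT oneT invT n a x) = cyclo_word mulU oneU invU n b (f x).
Proof.
move=> f1 fM fV fa; rewrite /cyclo_word.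
have fz z : f (zpow_gen mulT oneT invT x z) = zpow_gen mulU oneU invU (f x) z.
  have fi s : f (iter s (mulT x) oneT) = iter s (mulU (f x)) oneU.
    by elim: s => //= s IH; rewrite fM IH.
  by case: z => s; rewrite /zpow_gen ?fV fi.
have fia j y : f (iter j a y) = iter j b (f y) by elim: j => //= j IH; rewrite fa IH.
by elim: (iota _ _) => //= j s IH; rewrite fM fia fz IH.
Qed.

Lemma cycg_surj (G H : groupType) (f : G -> H) (a : G -> G) (b : H -> H) n :
  {morph f : x y / x * y} -> (forall u, exists x, f x = u) ->
  (forall x, f (a x) = b (f x)) -> cycg n a -> cycg n b.
Proof.
move=> fM fs fa cyc u; have [x <-] := fs u.
rewrite -(cyclo_word_morph n x (morph_g1 fM) fM (morph_gV fM) fa) cyc.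
exact: morph_g1.
Qed.

(** Phi divides the sum; both are monic of degree (p-1) p^e, so the cofactor is 1. *)
Lemma Cyclotomic_prime_power p e : prime p ->
  'Phi_(p ^ e.+1) = (\sum_(k < p) 'X^(k * p ^ e))%R.
Proof.
move=> p_pr; have p0 := prime_gt0 p_pr; have p1 := prime_gt1 p_pr.
have pe0 : 0 < p ^ e by rewrite expn_gt0 p0.
have n0 : 0 < p ^ e.+1 by rewrite expn_gt0 p0.
have pn : p %| p ^ e.+1 by rewrite expnS dvdn_mulr.
have [q] := Cyclotomic_dvd_trace n0 p_pr pn.
rewrite {1}expnS mulKn // => qE; rewrite qE.
have mon := Cyclotomic_monic (p ^ e.+1).
pose low : {poly int} := (\sum_(k < p.-1) 'X^(k * p ^ e))%R.
have sE : (\sum_(k < p) 'X^(k * p ^ e) = 'X^(p.-1 * p ^ e) + low :> {poly int})%R.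
  rewrite /low -!(big_mkord xpredT (fun k => 'X^(k * p ^ e) : {poly int})%R).
  by rewrite -{1}(prednK p0) big_nat_recr //= addrC.
have slow : size low < size ('X^(p.-1 * p ^ e) : {poly int})%R.
  rewrite size_polyXn ltnS; apply: (leq_trans (size_sum _ _ _)).
  apply/bigmax_leqP => k _; rewrite size_polyXn ltn_mul2r pe0 /=; exact: ltn_ord.
have sz : size (q * 'Phi_(p ^ e.+1))%R = (p.-1 * p ^ e).+1.
  by rewrite -qE sE size_polyDl // size_polyXn.
have lc : lead_coef (q * 'Phi_(p ^ e.+1))%R = 1%R.
  by rewrite -qE sE lead_coefDl // lead_coefXn.
rewrite lead_coef_Mmonic // in lc.
have q0 : (q != 0)%R by rewrite -lead_coef_eq0 lc.
move: sz; rewrite size_Mmonic // size_Cyclotomic totient_pfactor //=.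
move: (p.-1 * p ^ e)%N => D; rewrite addnS /= => sz.
have /size_poly1P [c _ qc] : size q == 1%N by rewrite -(eqn_add2r D) sz add1n.
by move: lc; rewrite qc lead_coefC => ->; rewrite mul1r.
Qed.

(** The coefficients are 1 at multiples of p^e and 0 elsewhere, and a zero exponent contributes a
    trivial letter; the order of the other letters is kept. *)
Lemma word_prime_power (G : groupType) (a : G -> G) p e x : prime p ->
  {morph a : x y / x * y} ->
  cyclo_word (@monoid.mul _) 1 (@monoid.inv _) (p ^ e.+1) a x =
  \prod_(0 <= k < p) iter (k * p ^ e) a x.
Proof.
move=> p_pr aM; have p0 := prime_gt0 p_pr; have p1 := prime_gt1 p_pr.
have pe0 : 0 < p ^ e by rewrite expn_gt0 p0.
have a1 j : iter j a 1 = 1 by elim: j => //= j ->; apply: morph_g1.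
pose Phi := 'Phi_(p ^ e.+1).
pose F j := iter j a (zpow_gen (@monoid.mul _) 1 (@monoid.inv _) x (Phi`_j)%R).
have wE s : foldr (fun i acc => F i * acc) 1 s = \prod_(j <- s) F j.
  by elim: s => [|j s IH]; rewrite ?big_nil ?big_cons //= IH.
rewrite /cyclo_word wE size_Cyclotomic totient_pfactor //.
have coefE j : j < p * p ^ e -> (Phi`_j)%R = ((p ^ e)%N %| j)%N%:R%R.
  move=> jp; rewrite /Phi Cyclotomic_prime_power // coef_sum.
  under eq_bigr do rewrite coefXn.
  have [/dvdnP [k jk]|nd] := boolP (p ^ e %| j).
    have kp : k < p by move: jp; rewrite jk ltn_mul2r pe0.
    rewrite (bigD1 (Ordinal kp)) //= jk eqxx big1 ?addr0 // => i ik.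
    rewrite eqn_mul2r (gtn_eqF pe0) /=; have [ki|//] := eqVneq k i.
    by case/eqP: ik; apply: val_inj; rewrite /= ki.
  rewrite big1 // => i _; case: eqP => // ji.
  by case/negP: nd; rewrite ji dvdn_mull.
have F1 k : k < p -> F (k * p ^ e)%N = iter (k * p ^ e) a x.
  move=> kp; rewrite /F coefE ?ltn_mul2r ?pe0 // dvdn_mull //.
  by congr iter; rewrite /zpow_gen /= mulg1.
have F0 j : j < p * p ^ e -> ~~ (p ^ e %| j) -> F j = 1.
  by move=> jp nd; rewrite /F coefE // (negPf nd) /=.
(* Each further block of p^e letters contributes only its last one. *)
have h m : m < p -> \prod_(0 <= j < (m * p ^ e).+1) F j = \prod_(0 <= k < m.+1) F (k * p ^ e)%N.
  elim: m => [|m IH] mp; first by rewrite !big_nat1.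
  rewrite [RHS]big_nat_recr //= -IH; last exact: ltnW.
  rewrite big_nat_recr //= (big_cat_nat (n := (m * p ^ e).+1)) //=; last first.
    by rewrite mulSn; lia.
  rewrite [X in _ * X * _]big_nat_cond [X in _ * X * _]big1 ?mulg1 // => j.
  rewrite andbT => /andP [j1 j2]; apply: F0.
    by apply: (leq_trans j2); rewrite leq_mul2r ltnW ?orbT.
  by apply/negP => /dvdnP [k jk]; move: j1 j2; rewrite jk !ltn_mul2r pe0 /=; lia.
rewrite [e.+1.-1]/= -[(p.-1 * p ^ e).+1]subn0 -/(index_iota 0 _).
rewrite h ?prednK // ?leqnn //; apply: eq_big_nat => k /andP [_ kp].
exact: F1.
Qed.

Lemma iter_morph (G : groupType) (a : G -> G) j : {morph a : x y / x * y} ->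
  {morph iter j a : x y / x * y}.
Proof. by move=> aM x y; elim: j => //= j ->; rewrite aM. Qed.

Lemma cycg_power (G : groupType) (a : G -> G) p e : prime p ->
  {morph a : x y / x * y} -> cycg (p ^ e.+1) a -> cycg p (iter (p ^ e) a).
Proof.
move=> p_pr aM cyc x; rewrite -{1}(expn1 p) word_prime_power //; last exact: iter_morph.
rewrite -[RHS](cyc x) word_prime_power //; apply: eq_big_nat => k _.
by rewrite expn0 muln1; elim: k => //= k ->; rewrite mulSn iterD.
Qed.

(** The words of x and of b x share the letters b x, ..., b^(p-1) x. This common product is inverse
    to x on one side and to b^p x on the other. *)
Lemma cycg_order (G : groupType) (b : G -> G) p x : prime p ->
  {morph b : x y / x * y} -> cycg p b -> iter p b x = x.
Proof.
move=> p_pr bM cyc.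
have w y : \prod_(0 <= k < p) iter k b y = 1.
  rewrite -[RHS](cyc y) -{2}(expn1 p) word_prime_power //.
  by apply: eq_big_nat => k _; rewrite expn0 muln1.
have := w x; have := w (b x); have p0 := prime_gt0 p_pr.
rewrite -(prednK p0) big_nat_recr //= big_nat_recl //=.
under eq_big_nat do rewrite -iterSr; rewrite -iterSr /= => h1 h2.
by apply: (mulgI (\prod_(0 <= i < p.-1) b (iter i b x))); rewrite h1; apply/esym;
  apply: (mulgI x); rewrite mulgA h2 mul1g mulg1.
Qed.

(** * Reduction to finite p-groups *)

Section KhukhroStep.
Variable C : nat -> nat -> nat.
Hypothesis HC : Khukhro_bound C.
Variables (G : groupType) (b : G -> G) (p : nat) (S : seq G) (c : nat).
Hypotheses (p_pr : prime p) (bM : {morph b : x y / x * y}) (bcyc : cycg p b).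
Hypothesis genS : forall x, genl S x.
Hypotheses (hc : p.-1 ^ (2 ^ p.-1) <= c) (hC : C (size S) p <= c).

Record good (z : G) (K : G -> Prop) : Prop := Good {
  good_sub : subgrp K;
  good_norm : conj_closed K;
  good_inv : forall x, K x -> K (b x);
  good_z : ~ K z;
  good_gam : forall x, gam c.+1 x -> K x
}.

Lemma good_max z : ~ gam c.+1 z -> exists2 K, good z K &
  forall K', good z K' -> (forall x, K x -> K' x) -> forall x, K' x -> K x.
Proof.
(* Zorn's lemma also asks about the empty chain, whose union is empty; adjoining [gam c.+1] to every
   set makes that union a good subgroup. *)
move=> ngz; pose U (A : G -> Prop) x := A x \/ gam c.+1 x.
have gg := @gam_subgrp G c.+1.
have [F FP tF|A [gA maxA]] := @classical_sets.Zorn_bigcup G (fun A => good z (U A)).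
  set B := classical_sets.bigcup _ _.
  have sub A x : F A -> U A x -> U B x.
    by move=> FA [Ax|gx]; [left; exists A | right].
  have case1 x : U B x -> (exists2 A, F A & U A x) \/ gam c.+1 x.
    by move=> [[A FA Ax]|gx]; [left; exists A => //; left | right].
  split.
  - split=> [|x y|x].
    + by right; apply: sg1.
    + move=> /case1 [[A FA Ax]|gx] /case1 [[A' FA' A'y]|gy].
      * have [AA'|A'A] := tF _ _ FA FA'.
          apply: (sub A') => //; apply: (sgM (good_sub (FP _ FA'))) => //.
          by case: Ax => [/AA'|]; [left|right].
        apply: (sub A) => //; apply: (sgM (good_sub (FP _ FA))) => //.
        by case: A'y => [/A'A|]; [left|right].
      * by apply: (sub A) => //; apply: (sgM (good_sub (FP _ FA))) => //; right.
      * by apply: (sub A') => //; apply: (sgM (good_sub (FP _ FA'))) => //; right.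
      * by right; apply: sgM.
    + move=> /case1 [[A FA Ax]|gx]; last by right; apply: sgV.
      by apply: (sub A) => //; apply: (sgV (good_sub (FP _ FA))).
  - move=> x y /case1 [[A FA Ax]|gx]; last by right; apply: gam_normal.
    by apply: (sub A) => //; apply: (good_norm (FP _ FA)).
  - move=> x /case1 [[A FA Ax]|gx]; last by right; apply: morph_gam.
    by apply: (sub A) => //; apply: (good_inv (FP _ FA)).
  - by move=> /case1 [[A FA Ax]|//]; apply: (good_z (FP _ FA)).
  - by move=> x gx; right.
exists (U A) => // K' gK' AK' x K'x.
have UK' : U K' = K'.
  apply: funext => y; apply: propext; split; last by left.
  by case=> // /(good_gam gK').
left; apply: contrapT => nAx; apply: (maxA K'); last by rewrite UK'.
split=> [y Ay|/(_ x K'x)//]; by apply: AK'; left.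
Qed.

Lemma gam_step (z : G) : gam c z -> gam c.+1 z.
Proof.
move=> gz; apply: contrapT => ngz.
have p0 := prime_gt0 p_pr; have p1 := prime_gt1 p_pr.
have [s zs] := gam_torsion bM bcyc p0 p_pr (dvdnn p) hc gz.
have [K gK maxK] := good_max ngz.
have [Q [pi [piM pis pik]]] := quotient_exists (conj (good_sub gK) (good_norm gK)).
have nz1 : pi z <> 1 by move/pik; apply: good_z.
have zs1 : pi z ^+ (p ^ s) = 1.
  by rewrite -(morph_gX piM); apply/pik; apply: good_gam gK _ zs.
have eqK x y : pi x = pi y -> pi (b x) = pi (b y).
  move=> xy; have : pi (x^-1 * y) = 1 by rewrite piM (morph_gV piM) xy mulVg.
  move/pik/(good_inv gK)/pik; rewrite bM piM (morph_gV bM) (morph_gV piM).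
  by move/(congr1 (fun u => pi (b x) * u)); rewrite mulVKg mulg1.
have [rep repK] := choice pis.
pose bQ u := pi (b (rep u)).
have bQE x : bQ (pi x) = pi (b x) by apply: eqK; rewrite repK.
have bQM : {morph bQ : u v / u * v}.
  move=> u v; have [x <-] := pis u; have [y <-] := pis v.
  by rewrite -piM !bQE bM piM.
have bQcyc : cycg p bQ by apply: (cycg_surj piM pis) bcyc => x; rewrite bQE.
have bQp u : iter p bQ u = u by apply: cycg_order.
have bQbij : bijective bQ.
  exists (iter p.-1 bQ) => u.
    by rewrite -iterSr prednK.
  by rewrite -iterS prednK.
have mono (N : Q -> Prop) : subgrp N -> conj_closed N ->
    (forall u, N u -> N (bQ u)) -> ~ N (pi z) -> forall u, N u -> u = 1.
  move=> gN nN bN nNz u; have [x <-] := pis u => Nx; apply/pik.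
  move: x Nx; apply: (maxK (fun x => N (pi x))); last first.
    by move=> x /pik ->; apply: sg1.
  split=> //.
  - split=> [|x y|x]; first by rewrite (morph_g1 piM); apply: sg1.
      by rewrite piM; apply: sgM.
    by rewrite (morph_gV piM); apply: sgV.
  - by move=> x y; rewrite conjg_commg piM (morph_gR piM) -conjg_commg; apply: nN.
  - by move=> x /bN; rewrite bQE.
  - by move=> x /(good_gam gK)/pik ->; apply: sg1.
have nilQ (u : Q) : gam c.+1 u -> u = 1.
  by case/(morph_gam_surj piM pis) => x /(good_gam gK)/pik ? <-.
have genQ u : genl (map pi S) u.
  have [x <-] := pis u; elim: (genS x) => [|y yS|y w _ IHy _ IHw|y _ IHy].
  - by rewrite (morph_g1 piM); apply: genp1.
  - by apply: genp_in; apply: map_f.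
  - by rewrite piM; apply: genpM.
  - by rewrite (morph_gV piM); apply: genpV.
have [l pl genl'] := pc_exists genQ nilQ.
have [M Mp hM] := pc_torsion pl.
(* M is an exponent for all torsion of Q, and p^M is a multiple of the p-part of M. If pi z =
   v^(p^M) with v central, then v has p-power order dividing M, so v^(p^M) = 1, against pi z <> 1.
   Hence N is trivial by maximality of K. *)
pose N u := exists2 v : Q, zeta 1 v & u = v ^+ (p ^ M).
have cen v w : zeta 1 v -> commute v w by move=> /(_ w) /= /eqP/commgP.
have [gz1 _] := zeta_normal Q 1.
have hN u : N u -> u = 1.
  apply: mono.
  - split=> [|_ _ [u1 z1 ->] [u2 z2 ->]|_ [u1 z1 ->]].
    + by exists 1; [apply: (sg1 gz1) | rewrite expg1n].
    + exists (u1 * u2); first exact: (sgM gz1).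
      by rewrite expgMn //; apply: cen.
    + by exists u1^-1; [apply: (sgV gz1) | rewrite expVgn].
  - move=> _ w [v zv ->]; exists v => //; rewrite conjXg.
    by congr (_ ^+ _); apply/conjg_fixP/commgP/cen.
  - move=> _ [v zv ->]; exists (bQ v); last exact: morph_gX.
    move=> w; have [bQ' _ bQK'] := bQbij; rewrite -(bQK' w) -(morph_gR bQM).
    by rewrite (zv (bQ' w)) (morph_g1 bQM).
  - move=> [v zv ve]; apply: nz1.
    have vM : v ^+ M = 1.
      apply: (hM v (p ^ M * p ^ s)%N) => //; first by rewrite -expnD expn_gt0 p0.
      by rewrite expgnA -ve.
    have g1 : subgrp (fun u : Q => u = 1).
      by split=> [//|? ? -> ->|? ->]; rewrite ?mulg1 ?invg1.
    have vs : v ^+ (p ^ (M + s)) = 1 by rewrite expnD expgnA -ve.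
    have vg := sg_gcdn g1 vM vs.
    have /(dvdn_pfactor _ _ p_pr) [i _ gi] := dvdn_gcdr M (p ^ (M + s)).
    have iM : i <= M.
      apply: leq_trans (ltnW (ltn_expl i p1)) _; rewrite -gi.
      by apply: dvdn_leq => //; apply: dvdn_gcdl.
    rewrite ve -(subnKC iM) expnD expgnA -gi vg expg1n //.
have expQ (u : Q) : u ^+ ((p ^ M) ^ c.+1) = 1.
  apply: nil_exponent => // v zv; apply: hN; exists v => //.
have pM0 : 0 < (p ^ M) ^ c.+1 by rewrite !expn_gt0 p0.
have [t ht] := pc_finite pl pM0 expQ.
have [gT [phi [[psi phiK psiK] phiM]]] := fin_exists (fun u => ht u (genl' u)).
have phis u : exists x, phi x = u by exists (psi u).
have expT (u : gT) : u ^+ ((p ^ M) ^ c.+1) = 1.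
  by rewrite -(psiK u) -(morph_gX phiM) expQ (morph_g1 phiM).
have pT : pgroup p [set: gT].
  apply/pgroupP => q q_pr /(Cauchy q_pr) [u _ uq].
  have : #[u] %| (p ^ M) ^ c.+1 by rewrite order_dvdn expT.
  by rewrite uq -expnM Euclid_dvdX // dvdn_prime2 // => /andP [qp _]; rewrite inE.
have genT : <<[set x in map phi (map pi S)]>> = [set: gT].
  apply/setP => u; rewrite inE -(psiK u).
  elim: (genQ (psi u)) => [|y yS|y w _ IHy _ IHw|y _ IHy].
  - by rewrite (morph_g1 phiM) group1.
  - by apply: mem_gen; rewrite inE; apply: map_f.
  - by rewrite phiM groupM.
  - by rewrite (morph_gV phiM) groupV.
have sz : size (map phi (map pi S)) == size S by rewrite !size_map.
have aut : exists f : gT -> gT,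
    [/\ bijective f, {morph f : x y / x * y} & cycg p f].
  exists (fun u => phi (bQ (psi u))); split.
  - apply: bij_comp; first by exists psi.
    by apply: bij_comp => //; exists phi.
  - move=> u v; have [x <-] := phis u; have [y <-] := phis v.
    by rewrite -phiM !phiK bQM phiM.
  - by apply: (cycg_surj phiM phis) bQcyc => x; rewrite phiK.
have [nilT clT] := HC p_pr pT (ex_intro _ (Tuple sz) genT) aut.
have gamL i (u : Q) : gam i u -> phi u \in 'L_i.+1([set: gT]).
  elim: i u => [|i IH] u /=; first by rewrite inE.
  elim=> [|_ [y [w [gy ->]]]|y w _ IHy _ IHw|y _ IHy].
  - by rewrite (morph_g1 phiM) group1.
  - by rewrite (morph_gR phiM) lcnSn mem_commg ?IH ?inE.
  - by rewrite phiM groupM.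
  - by rewrite (morph_gV phiM) groupV.
(* [gam c] corresponds to ['L_c.+1], which is trivial for class at most c; this kills the image of
   z. *)
have L1 : 'L_c.+1([set: gT]) = 1%G.
  by apply/(lcn_nil_classP _ nilT); apply: leq_trans clT hC.
apply: nz1; have := gamL c (pi z) (morph_gam piM gz).
rewrite L1 inE => /eqP pz; apply: (can_inj phiK).
by rewrite pz (morph_g1 phiM).
Qed.

End KhukhroStep.

(** * Transfer to the groups of the statement *)

Section GrpMorphisms.
Variables (H : groupType) (G : grp) (iota : H -> G).
Hypothesis iM : {morph iota : x y / x * y >-> gmul x y}.

Lemma gmulI (x y z : G) : gmul x y = gmul x z -> y = z.
Proof. by move=> e; rewrite -(gmul1 y) -(gmulV x) -gmulA e gmulA gmulV gmul1. Qed.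

Lemma gmul_inv (x y : G) : gmul x y = gone G -> ginv x = y.
Proof. by move=> e; apply: (gmulI (x := x)); rewrite e gmulrV. Qed.

Lemma iota1 : iota 1 = gone G.
Proof. by apply: (gmulI (x := iota 1)); rewrite -iM mulg1 gmulr1. Qed.

Lemma iotaV : {morph iota : x / x^-1 >-> ginv x}.
Proof. by move=> x; apply/esym/gmul_inv; rewrite -iM mulgV iota1. Qed.

Lemma iotaR x y : iota [~ x, y] = gcomm (iota x) (iota y).
Proof. by rewrite /commg /conjg /gcomm !iM !iotaV !gmulA. Qed.

Lemma gam_lcs (N : G -> Prop) i x : (forall u, N (iota u)) -> gam i x -> lcs N i (iota x).
Proof.
move=> Ni; elim: i x => [|i IH] x /=; first by move=> _; apply: Ni.
elim=> [|_ [u [v [gu ->]]]|u v _ IHu _ IHv|u _ IHu].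
- by rewrite iota1; apply: gen_one.
- rewrite iotaR; apply: gen_in; exists (iota u), (iota v).
  by split; [apply: IH | split=> //; apply: Ni].
- by rewrite iM; apply: gen_mul.
- by rewrite iotaV; apply: gen_inv.
Qed.

Lemma lcs_gam (N : G -> Prop) i x : (forall x, N x -> exists u, iota u = x) ->
  lcs N i x -> exists2 u, gam i u & iota u = x.
Proof.
move=> Ni; elim: i x => [|i IH] x /=; first by move=> /Ni [u <-]; exists u.
elim=> [|_ [_ [_ [/IH [u gu <-] [/Ni [v <-] ->]]]]|_ _ _ [u gu <-] _ [v gv <-]|_ _ [u gu <-]].
- by exists 1; [apply: genp1 | apply: iota1].
- by exists [~ u, v]; [apply: gam_comm | apply: iotaR].
- by exists (u * v); [apply: genpM | apply: iM].
- by exists u^-1; [apply: genpV | apply: iotaV].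
Qed.

End GrpMorphisms.

(** * Finitely generated invariant subgroups *)

Section OrbitGroup.
Variables (G : grp) (a : G -> G) (n M k : nat) (gens : 'I_k -> G).
Hypothesis aM : {morph a : x y / gmul x y}.
Hypothesis cyc : cyclotomic_map (@gmul G) (gone G) (@ginv G) n a.
Hypotheses (n0 : 0 < n) (nM : totient n <= M).

(** M may be any number from totient n on: C is not assumed monotone in the number of generators,
    and M = 2p - 3 gives a generating list of length exactly (2p-3)k. *)
Definition orbit_gens (x : G) := exists i j, i < M /\ x = iter i a (gens j).

Let Hp := gen orbit_gens.

Let Hp_closed : grp_closed Hp.
Proof. by split; [apply: gen_one | apply: gen_mul | apply: gen_inv]. Qed.

Let a1 : a (gone G) = gone G.
Proof. by apply: (gmulI (x := a (gone G))); rewrite -aM gmul1 gmulr1. Qed.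

Let aV : {morph a : x / ginv x}.
Proof. by move=> x; apply/esym/gmul_inv; rewrite -aM gmulrV a1. Qed.

Let HpMl x y : Hp x -> Hp (gmul x y) -> Hp y.
Proof.
move=> Hx Hxy; have -> : y = gmul (ginv x) (gmul x y) by rewrite gmulA gmulV gmul1.
by apply: gen_mul => //; apply: gen_inv.
Qed.

(* The cyclotomic polynomial is monic, so the word expresses its last iterate
   through the previous ones. *)
Lemma orbit_last x : (forall i, i < totient n -> Hp (iter i a x)) ->
  Hp (iter (totient n) a x).
Proof.
move=> hx; have := cyc x; rewrite /cyclo_word size_Cyclotomic -addn1 iotaD add0n /=.
have zp i z : Hp (iter i a x) ->
    Hp (iter i a (zpow_gen (@gmul G) (gone G) (@ginv G) x z)).
  move=> hi; have pw s : Hp (iter i a (iter s (gmul x) (gone G))).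
    elim: s => [|s IH] /=.
      by have -> : iter i a (gone G) = gone G; [elim: (i) => //= j -> | apply: gen_one].
    by have -> u v : iter i a (gmul u v) = gmul (iter i a u) (iter i a v);
      [elim: (i) => //= j ->; rewrite aM | apply: gen_mul].
  case: z => s; rewrite /zpow_gen; first exact: pw.
  by have -> u : iter i a (ginv u) = ginv (iter i a u);
    [elim: (i) => //= j ->; rewrite aV | apply/gen_inv/pw].
have := Cyclotomic_monic n; rewrite monicE lead_coefE size_Cyclotomic /= => /eqP lc.
have mem i : i \in iota 0 (totient n) -> i < totient n by rewrite mem_iota.
move: mem; move: (iota 0 (totient n)) => s mem wE.
have {wE} : Hp (foldr (fun i acc => gmul (iter i a (zpow_gen (@gmul G) (gone G) (@ginv G) x
    (('Phi_n)`_i)%R)) acc) (gone G) (s ++ [:: totient n])) by rewrite wE; apply: gen_one.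
elim: s mem => [|i s IH] mem /=.
  by rewrite lc /zpow_gen /= !gmulr1.
move=> hw; apply: IH; first by move=> j js; apply: mem; rewrite inE js orbT.
by apply: HpMl hw; apply/zp/hx/mem; rewrite inE eqxx.
Qed.

Lemma orbit_closed x : Hp x -> Hp (a x).
Proof.
elim=> {x} [|_ [i [j [iM ->]]]|x y _ Hx _ Hy|x _ Hx].
- by rewrite a1; apply: gen_one.
- rewrite -iterS; have [lt|ge] := ltnP i.+1 M; first by apply: gen_in; exists i.+1, j.
  (* Here i + 1 = M; starting the recurrence at the iterate of index M - totient n keeps all the
     earlier iterates among the generators. *)
  have -> : i.+1 = (totient n + (M - totient n))%N by lia.
  rewrite iterD; apply: orbit_last => l lt; rewrite -iterD.
  by apply: gen_in; exists (l + (M - totient n))%N, j; split=> //; lia.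
- by rewrite aM; apply: gen_mul.
- by rewrite aV; apply: gen_inv.
Qed.

Lemma orbit_group : exists (H : groupType) (iota : H -> G) (b : H -> H) (h : 'I_k -> H),
  [/\ injective iota, {morph iota : x y / x * y >-> gmul x y},
      {morph b : x y / x * y}, cycg n b & forall u, gen orbit_gens (iota u)] /\
  [/\ forall j, iota (h j) = gens j &
      forall x, genl [seq iter i b (h j) | i <- seq.iota 0 M, j <- enum 'I_k] x].
Proof.
have [H [iota [i_inj iM iP]]] := subgroup_exists Hp_closed.
have Hi u : Hp (iota u) by apply/iP; exists u.
have [b bE] := choice (fun u => proj1 (iP _) (orbit_closed (Hi u))).
have M0 : 0 < M by apply: leq_trans nM; rewrite totient_gt0.
have Hg j : Hp (gens j) by apply: gen_in; exists 0%N, j.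
have [h hE] := choice (fun j => proj1 (iP _) (Hg j)).
exists H, iota, b, h; split; last first.
  split=> // x.
  have itE i j : iota (iter i b (h j)) = iter i a (gens j).
    by elim: i => //= i IH; rewrite bE IH.
  suff [u gu /i_inj <-] : exists2 u, genl [seq iter i b (h j) | i <- seq.iota 0 M, j <- enum 'I_k] u
      & iota u = iota x by [].
  elim: (Hi x) => [|_ [i [j [lt ->]]]|_ _ _ [u gu <-] _ [v gv <-]|_ _ [u gu <-]].
  - by exists 1; [apply: genp1 | apply: iota1].
  - exists (iter i b (h j)); last exact: itE.
    apply: genp_in; apply/allpairsP; exists (i, j).
    by rewrite mem_iota mem_enum.
  - by exists (u * v); [apply: genpM | apply: iM].
  - by exists u^-1; [apply: genpV | apply: iotaV].
split=> // [x y|x].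
  by apply: i_inj; rewrite bE !iM aM !bE.
apply: i_inj; rewrite (cyclo_word_morph n x (iota1 iM) iM (iotaV iM) bE) cyc.
by rewrite (iota1 iM).
Qed.

End OrbitGroup.

Lemma orbit_gens_fin (G : grp) (a : G -> G) M k (gens : 'I_k -> G) :
  exists m (g : 'I_m -> G), orbit_gens a M gens = (fun x => exists i, x = g i).
Proof.
pose v (i : 'I_#|{: 'I_M * 'I_k}|) : 'I_M * 'I_k := enum_val i.
exists #|{: 'I_M * 'I_k}|, (fun i => iter (v i).1 a (gens (v i).2)).
apply: funext => x; apply: propext; split=> [[i [j [lt ->]]]|[i ->]].
  by exists (enum_rank (Ordinal lt, j)); rewrite /v enum_rankK.
by exists (v i).1, (v i).2; split.
Qed.

Lemma higman_bound_mono r p : 0 < r -> r <= p ->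
  r.-1 ^ (2 ^ r.-1) <= (p - 1) ^ (2 ^ (p - 1)).
Proof.
move=> r0 rp; rewrite subn1; have le : r.-1 <= p.-1 by lia.
apply: (@leq_trans (p.-1 ^ (2 ^ r.-1))); first by rewrite leq_exp2r ?expn_gt0.
have [-> |p1] := posnP p.-1; first by rewrite !exp0n ?expn_gt0.
by rewrite leq_pexp2l // leq_pexp2l.
Qed.

Local Close Scope group_scope.

Theorem theorem7p9 (C : nat -> nat -> nat) (HC : Khukhro_bound C)
  (n : nat) (G : grp) (a : G -> G) :
  1 < n -> locally_nilpotent G -> n_cyclotomic_aut n a ->
  let p := max_pdiv n in
  forall (k : nat) (gens : 'I_k -> G),
    nil_class_le (gen (fun x => exists i, x = gens i))
      (maxn ((p - 1) ^ (2 ^ (p - 1))) (C ((2 * p - 3) * k) p)).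
Proof.
move=> n1 locnil [[_ aM] cyc] p k gens z; set c := maxn _ _.
have n0 : 0 < n by exact: ltnW.
have p_pr : prime p by apply: max_pdiv_prime.
have [H [iota [b [h [[i_inj iM bM bcyc Hi] [hE genH]]]]]] :=
  orbit_group gens aM cyc n0 (leqnn (totient n)).
have [e nilH] : exists e, forall x : H, gam e x -> x = 1%g.
  have [m [g gE]] := orbit_gens_fin a (totient n) gens.
  have [e he] := locnil m g; exists e => x gx; apply: i_inj.
  rewrite (iota1 iM); apply: he; rewrite -gE.
  exact: (gam_lcs iM).
have genN (K : groupType) (f : K -> H) (h' : 'I_k -> K) : {morph f : x y / (x * y)%g} ->
    (forall j, f (h' j) = h j) ->
    forall x, gen (fun x => exists i, x = gens i) x -> exists u, iota (f u) = x.
  move=> fM fh x; elim=> [|_ [j ->]|_ _ _ [u <-] _ [v <-]|_ _ [u <-]].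
  - by exists 1%g; rewrite (morph_g1 fM) (iota1 iM).
  - by exists (h' j); rewrite fh hE.
  - by exists (u * v)%g; rewrite fM iM.
  - by exists u^-1%g; rewrite (morph_gV fM) (iotaV iM).
have hr r : prime r -> r %| n -> r.-1 ^ (2 ^ r.-1) <= c.
  move=> r_pr rn; apply: leq_trans (leq_maxl _ _).
  apply: higman_bound_mono; first exact: prime_gt0.
  by apply: max_pdiv_max; rewrite mem_primes r_pr n0.
have [[r r_pr [rp rn]]|np] := pselect (exists2 r, prime r & r != p /\ r %| n).
  have st (y : H) : gam c y -> gam c.+1 y.
    move=> gy; have [s1 y1] := gam_torsion bM bcyc n0 r_pr rn (hr r r_pr rn) gy.
    have pn : p %| n by apply: max_pdiv_dvd.
    have [s2 y2] := gam_torsion bM bcyc n0 p_pr pn (hr p p_pr pn) gy.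
    have := sg_gcdn (gam_subgrp c.+1) y1 y2.
    (* Coprime powers of y lie in [gam c.+1], hence so does y. *)
    have /eqP -> : coprime (r ^ s1) (p ^ s2).
      by apply/coprimeXl/coprimeXr; rewrite prime_coprime // dvdn_prime2.
    by [].
  case/(lcs_gam iM (genN H id h _ _)) => // u /(gam_stable st nilH) -> <-.
  exact: iota1.
have [e' nE] : exists e', n = p ^ e'.+1.
  have pn : p.-nat n.
    apply/pnatP => // q q_pr qn; rewrite inE; apply/negPn/negP => qp.
    by apply: np; exists q.
  exists (logn p n).-1; rewrite prednK ?part_pnat_id -?p_part ?part_pnat_id //.
  by rewrite logn_gt0 mem_primes p_pr n0 max_pdiv_dvd.
have bcyc' : cycg (p ^ e'.+1) b by rewrite -nE.
have betacyc := cycg_power p_pr bM bcyc'.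
have betaM := iter_morph (p ^ e') bM.
have p1 := prime_gt1 p_pr.
have tM : totient p <= 2 * p - 3 by rewrite totient_prime //; lia.
(* The number of generators of H depends on n. Iterates of the same elements under the p-cyclotomic
   power of b generate a subgroup K of H that still contains N and has a generating list of length
   (2p-3)k. *)
have [K [f [d [h' [[f_inj fM dM dcyc _] [h'E genK]]]]]] :=
  @orbit_group (grp_of H) _ p _ k h betaM betacyc (prime_gt0 p_pr) tM.
have nilK (x : K) : gam e x -> x = 1%g.
  move=> gx; apply: f_inj; rewrite (morph_g1 (H := H) fM); apply: nilH.
  exact: (morph_gam (H := H) fM).
have st (y : K) : gam c y -> gam c.+1 y.
  apply: (gam_step HC p_pr dM dcyc genK); first by apply: hr => //; apply: max_pdiv_dvd.
  by rewrite size_allpairs size_iota size_enum_ord leq_maxr.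
have fiM : {morph (fun u => iota (f u)) : x y / (x * y)%g >-> gmul x y}.
  by move=> x y; rewrite /= fM iM.
case/(lcs_gam fiM (genN K f h' fM h'E)) => u /(gam_stable st nilK) -> <-.
by rewrite (morph_g1 (H := H) fM) (iota1 iM).
Qed.
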